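(* Let $D$ be a simple derivation of $\Bbbk[x_1,\dots,x_n]$ such that $\operatorname{Aut}(D)$ contains a non-trivial normal subgroup $H\cong\mathbb G_a^s$, $s\ge 1$, acting in a globally trivial way on $\mathbb A^n$. Consider an $H$-equivariant isomorphism $\mathbb A^n\cong\mathbb A^s\times V$ as in the definition of global triviality, and let $\overline D=D|_{\Bbbk[V]}:\Bbbk[V]\to\Bbbk[V]$ be the restriction of $D$. Assume moreover that $\operatorname{Aut}(\overline D)$ is algebraic. Then $\operatorname{Aut}(D)$ is algebraic; in particular, $\operatorname{Aut}(D)=\operatorname{Aut}(D)^0$.
   Context: $\Bbbk$ is an algebraically closed field of characteristic $0$ and $\mathbb G_a=(\Bbbk,+)$. A derivation $D$ of $\Bbbk[x_1,\dots,x_n]$ is a $\Bbbk$-linear endomorphism with $D(fg)=D(f)g+fD(g)$; it is simple if the only ideals $I$ with $D(I)\subset I$ are the trivial ones. For a derivation $D$ of a $\Bbbk$-algebra $B$, $\operatorname{Aut}(D)$ is the group of $\Bbbk$-algebra automorphisms of $B$ commuting with $D$; for $B=\Bbbk[V]$ it is identified with a subgroup of $\operatorname{Aut}(V)$. $\operatorname{Aut}(\Bbbk[x_1,\dots,x_n])\cong\operatorname{Aut}(\mathbb A^n)$ is an ind-group, with filtration $\{\varphi=(f_1,\dots,f_n): \deg f_i\le p\ \forall i\}$, $f_i=\varphi(x_i)$; similarly $\operatorname{Aut}(V)$ is an ind-group for $V$ an affine variety (filtering by degree with respect to a closed embedding of $V$ in an affine space). $\operatorname{Aut}(D)$ and $\operatorname{Aut}(\overline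 D)$ are closed subgroups. A closed subgroup of such an ind-group is called algebraic if it is contained in one of the pieces of the filtration. $\operatorname{Aut}(D)^0$ is the connected component of $\operatorname{Aut}(D)$ containing the identity. A regular action of $\mathbb G_a^s$ on an affine variety $X$ is globally trivial if there exist an affine algebraic variety $V$ and an isomorphism $X\cong\mathbb A^s\times V$ which is equivariant for the action $(a,(t,v))\mapsto(t+a,v)$ of $\mathbb G_a^s$ on $\mathbb A^s\times V$. In this case $\Bbbk[V]=\Bbbk[X]^{\mathbb G_a^s}$, and if $X=\mathbb A^n$ and $\mathbb G_a^s\cong H\subset\operatorname{Aut}(D)$, then $D$ maps $\Bbbk[V]=\Bbbk[x_1,\dots,x_n]^H$ into itself. *)

(* Defs.v *)
From HB Require Import structures.
From mathcomp Require Import all_boot all_order all_algebra.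
From mathcomp Require Import boolp classical_sets functions.
From mathcomp Require Import topology_structure connected.
From mathcomp.multinomials Require Import mpoly.

Set Implicit Arguments.
Unset Strict Implicit.
Unset Printing Implicit Defensive.

Import GRing.Theory.
Local Open Scope classical_set_scope.
Local Open Scope ring_scope.

Section Derivations.
Context {R : comNzRingType}.

Definition leibniz (D : R -> R) := forall f g, D (f * g) = D f * g + f * D g.

Definition ideal (I : set R) :=
  [/\ I 0, (forall f g, I f -> I g -> I (f + g)) &
      (forall f g, I g -> I (f * g))].

Definition simple (D : R -> R) :=
  forall I : set R, ideal I -> (forall f, I f -> I (D f)) ->
    I = [set 0] \/ I = setT.

End Derivations.

Definition reduced (R : nzRingType) :=
  forall (b : R) (e : nat), b ^+ e = 0 -> b = 0.

(* An affine variety V is given by its coordinate ring B = k[V], and a closed *)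
(* embedding of V in the affine m-space by the corresponding surjection       *)
(* emb : k[y_1, .., y_m] -> k[V].                                             *)
Definition closed_embedding (k : fieldType) (B : comAlgType k) (m : nat)
    (emb : {lrmorphism {mpoly k[m]} -> B}) :=
  forall b, exists P, emb P = b.

(* The index emb does not affect the elements: it records the embedding with  *)
(* respect to which degrees, hence the ind-topology, are taken.               *)
Record aut (k : fieldType) (B : comAlgType k) (m : nat)
    (emb : {lrmorphism {mpoly k[m]} -> B}) := Aut {
  aut_fun :> {lrmorphism B -> B};
  aut_inv : {lrmorphism B -> B};
  aut_funK : cancel aut_fun aut_inv;
  aut_invK : cancel aut_inv aut_fun
}.

Section AutGroup.
Context (k : fieldType) (B : comAlgType k) (m : nat).
Context (emb : {lrmorphism {mpoly k[m]} -> B}).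
Implicit Types phi psi : aut emb.

Lemma lrmorphism_ext (f g : {lrmorphism B -> B}) : f =1 g -> f = g.
Proof.
move: f g => [f [[f1] [f2] [f3]]] [g [[g1] [g2] [g3]]] /= /funext fg.
move: f1 f2 f3; rewrite fg => f1 f2 f3.
by rewrite (Prop_irrelevance f1 g1) (Prop_irrelevance f2 g2)
           (Prop_irrelevance f3 g3).
Qed.

Lemma aut_ext phi psi : phi =1 psi -> phi = psi.
Proof.
move: phi psi => [f f' fK f'K] [g g' gK g'K] /= fg.
have efg : f = g by apply: lrmorphism_ext.
have efg' : f' = g'.
  by apply: lrmorphism_ext => x; rewrite -{1}(g'K x) -fg fK.
move: fK f'K; rewrite efg efg' => fK f'K.
by rewrite (Prop_irrelevance fK gK) (Prop_irrelevance f'K g'K).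
Qed.

HB.instance Definition _ := gen_eqMixin (aut emb).
HB.instance Definition _ := gen_choiceMixin (aut emb).

Definition aut_one : aut emb :=
  @Aut _ _ _ emb idfun idfun (fun=> erefl) (fun=> erefl).

Definition aut_mul phi psi : aut emb :=
  @Aut _ _ _ emb (phi \o psi) (aut_inv psi \o aut_inv phi)
    (can_comp (aut_funK phi) (aut_funK psi))
    (can_comp (aut_invK psi) (aut_invK phi)).

Definition aut_Inv phi : aut emb :=
  @Aut _ _ _ emb (aut_inv phi) phi (aut_invK phi) (aut_funK phi).

Lemma aut_mulA : associative aut_mul.
Proof. by move=> f g h; apply: aut_ext. Qed.

Lemma aut_mul1g : left_id aut_one aut_mul.
Proof. by move=> f; apply: aut_ext. Qed.

Lemma aut_mulg1 : right_id aut_one aut_mul.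
Proof. by move=> f; apply: aut_ext. Qed.

Lemma aut_mulVg : left_inverse aut_one aut_Inv aut_mul.
Proof. by move=> f; apply: aut_ext => x /=; rewrite aut_funK. Qed.

Lemma aut_mulgV : right_inverse aut_one aut_Inv aut_mul.
Proof. by move=> f; apply: aut_ext => x /=; rewrite aut_invK. Qed.

HB.instance Definition _ := isGroup.Build (aut emb)
  aut_mulA aut_mul1g aut_mulg1 aut_mulVg aut_mulgV.

(* b has degree at most p in the embedding emb: it is the restriction to V of *)
(* a polynomial of degree at most p (msize is the degree plus one).           *)
Definition deg_le (p : nat) (b : B) :=
  exists2 P : {mpoly k[m]}, (msize P <= p.+1)%N & emb P = b.

Definition aut_piece (p : nat) : set (aut emb) :=
  [set phi | forall i, deg_le p (phi (emb 'X_i))].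

(* The coordinates of an m-tuple of polynomials of degree at most p are its   *)
(* coefficients, indexed by a component and a monomial of degree at most p.   *)
Definition coord_index (p : nat) : finType := ('I_m * 'X_{1..m < p.+1})%type.

Definition coords (p : nat) (P : 'I_m -> {mpoly k[m]}) :
    'I_#|coord_index p| -> k :=
  fun j => (P (enum_val j).1)@_(enum_val j).2.

(* C meets the p-th piece in a Zariski closed subset of it: for phi in the    *)
(* piece, membership in C amounts to polynomial equations S in the            *)
(* coefficients of polynomials P_i of degree at most p that represent the     *)
(* phi (y_i). The P_i are unique when emb is injective; in general, the       *)
(* functions of degree at most p form a quotient of the vector space of       *)
(* polynomials of degree at most p and carry the quotient Zariski topology.   *)
Definition closed_in_piece (C : set (aut emb)) (p : nat) :=
  exists S : set {mpoly k[#|coord_index p|]},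
    forall phi (P : 'I_m -> {mpoly k[m]}),
      (forall i, (msize (P i) <= p.+1)%N) ->
      (forall i, emb (P i) = phi (emb 'X_i)) ->
      (C phi <-> forall q, S q -> q.@[coords P] = 0).

Definition ind_closed (C : set (aut emb)) := forall p, closed_in_piece C p.
Definition ind_open (U : set (aut emb)) := ind_closed (~` U).

Lemma ind_openT : ind_open setT.
Proof.
move=> p; exists [set 1] => phi P _ _; rewrite setCT; split=> [[]|] /(_ 1 erefl).
by rewrite meval1 => /eqP; rewrite oner_eq0.
Qed.

Lemma ind_openI : setI_closed ind_open.
Proof.
move=> U W Uo Wo p; have [S SP] := Uo p; have [T TP] := Wo p.
exists [set q | exists a b, [/\ S a, T b & q = a * b]] => phi P Pp Pphi.
have {}SP := SP _ _ Pp Pphi; have {}TP := TP _ _ Pp Pphi.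
rewrite setCI; split=> [|ST].
  by move=> + q [a [b [Sa Tb ->]]]; rewrite mevalM =>
    -[/SP/(_ _ Sa)|/TP/(_ _ Tb)] ->; rewrite ?mul0r ?mulr0.
have [/SP|nS] := pselect (forall q, S q -> q.@[coords P] = 0); first by left.
right; apply/TP => b Tb; have [a Sa aN0] : exists2 a, S a & a.@[coords P] != 0.
  apply: contrapT => N; apply: nS => q Sq; apply: contrapT => /eqP qN0.
  by apply: N; exists q.
have := ST (a * b) (ex_intro _ a (ex_intro _ b (And3 Sa Tb erefl))).
by rewrite mevalM => /eqP; rewrite mulf_eq0 (negPf aN0) => /eqP.
Qed.

Lemma ind_open_bigU (J : Type) (U : J -> set (aut emb)) :
  (forall i, ind_open (U i)) -> ind_open (\bigcup_i U i).
Proof.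
move=> Uo p; pose cut i (S : set {mpoly k[#|coord_index p|]}) :=
  forall phi (P : 'I_m -> {mpoly k[m]}),
      (forall i, (msize (P i) <= p.+1)%N) ->
      (forall i, emb (P i) = phi (emb 'X_i)) ->
      ((~` U i) phi <-> forall q, S q -> q.@[coords P] = 0).
exists [set q | exists i S, cut i S /\ S q] => phi P Pp Pphi.
rewrite setC_bigcup; split=> [UC q [i [S [cS Sq]]]|allS i _].
  by apply: ((cS phi P Pp Pphi).1 (UC i I)).
have [S cS] := Uo i p; apply/(cS phi P Pp Pphi) => q Sq.
by apply: allS; exists i, S.
Qed.

HB.instance Definition _ :=
  isOpenTopological.Build (aut emb) ind_openT ind_openI ind_open_bigU.

Lemma closed_autE (C : set (aut emb)) : closed C <-> ind_closed C.
Proof. by rewrite -openC /open /= /ind_open setCK. Qed.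

Definition algebraic (G : set (aut emb)) :=
  closed G /\ exists p, G `<=` aut_piece p.

Definition autD (D : B -> B) : set (aut emb) :=
  [set phi | forall b, phi (D b) = D (phi b)].

Definition identity_component (G : set (aut emb)) : set (aut emb) :=
  connected_component G 1%g.

End AutGroup.

Arguments autD {k B m} emb D _.

Definition normal_subgroup (G : groupType) (K H : set G) :=
  [/\ H `<=` K, H 1%g,
      (forall x y, H x -> H y -> H (x * y)%g),
      (forall x, H x -> H x^-1%g) &
      (forall g x, K g -> H x -> H (g * x * g^-1)%g)].

Definition affine_emb (k : fieldType) (n : nat) :
  {lrmorphism {mpoly k[n]} -> {mpoly k[n]}} := idfun.

Definition autA (k : fieldType) (n : nat) := aut (affine_emb k n).

Lemma aut_piece_affineE (k : fieldType) (n p : nat) (phi : autA k n) :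
  aut_piece p phi <-> forall i, (msize (phi 'X_i) <= p.+1)%N.
Proof.
by split=> phip i; [have [P Pp <-] := phip i | exists (phi 'X_i); first exact: phip].
Qed.

Section Actions.
Context (k : fieldType) (n s : nat).

(* 'rV[k]_s is the group of points of G_a^s.                                  *)
Definition isomorphic_Ga (H : set (autA k n)) (h : 'rV[k]_s -> autA k n) :=
  [/\ (forall a b, h (a + b) = (h a * h b)%g), injective h & range h = H].

Definition regular_action (h : 'rV[k]_s -> autA k n) :=
  exists rho : 'I_n -> {mpoly {mpoly k[n]}[s]},
    forall a i, h a 'X_i = (rho i).@[fun j => (a 0 j)%:MP].

(* Comorphism of (t, v) |-> (t + a, v) on k[A^s x V] = k[V][t_1, .., t_s].    *)
Definition translation (B : comAlgType k) (a : 'rV[k]_s)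
    (F : {mpoly B[s]}) : {mpoly B[s]} :=
  F \mPo [tuple 'X_j + ((a 0 j)%:A)%:MP | j < s].

(* Psi is the comorphism of an equivariant isomorphism A^s x V -> A^n.        *)
Definition equivariant_trivialization (h : 'rV[k]_s -> autA k n)
    (B : comAlgType k) (Psi : {rmorphism {mpoly k[n]} -> {mpoly B[s]}}) :=
  [/\ bijective Psi,
      (forall c : k, Psi c%:MP = (c%:A)%:MP) &
      (forall a f, Psi (h a f) = translation a (Psi f))].

(* The projection A^n -> V identifies b in k[V] with the f such that          *)
(* Psi f = b%:MP.                                                             *)
Definition is_restriction (B : comAlgType k)
    (Psi : {rmorphism {mpoly k[n]} -> {mpoly B[s]}})
    (D : {mpoly k[n]} -> {mpoly k[n]}) (Dbar : B -> B) :=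
  forall f b, Psi f = b%:MP -> Psi (D f) = (Dbar b)%:MP.

End Actions.

(* Main.v *)
(* A = k[x_1, .., x_n] is identified with B[t_1, .., t_s], H acting by translations
   of the t_j; in characteristic 0 its invariants are B.

   Bounded degree. An element phi of Aut(D) normalizes H, hence restricts to an
   element of Aut(Dbar), so phi(b) has bounded degree for each b in B. As D t_j is
   H-invariant, D (phi t_j) = phi (D t_j) has bounded degree as well, and so has
   phi t_j: the kernel of a simple derivation is k, so D^-1 of a space of finite
   dimension has finite dimension.

   Connectedness. Let g in Aut(D). Its powers have bounded degree, so A is the sum
   of the generalized eigenspaces of g. If the only eigenvalue is 1, then the
   coordinates of g^m are polynomial in m, and the set of powers of g is connected;
   it contains 1 and g. Otherwise let x_j be weight vectors that generate A, with
   weights l_j. For a multiplicative set Gamma of scalars, the ideal of the x_j with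
   l_j not in Gamma is D-stable, hence contains 1 unless it is 0. Reduce g, the x_j,
   the l_j and these finitely many identities to a finite field F, keeping some
   l_j <> 1, and let a prime p divide the order of its reduction. For Gamma the set
   of scalars whose reduction has order prime to p, the identity shows that a point
   of F^n fixed by g^r has p dividing r. But |F^n| is prime to p because p divides
   |F| - 1, so that some g^r with r prime to p has a fixed point. *)

(* Loaded before Defs, whose [simple] is not to be hidden by that of groups. *)
From mathcomp Require Import all_fingroup all_solvable.
Require Import Defs.
From HB Require Import structures.
From mathcomp Require Import all_boot all_order all_algebra.
From mathcomp Require Import boolp classical_sets functions.
From mathcomp Require Import topology_structure connected.
From mathcomp.multinomials Require Import mpoly.
From mathcomp Require Import all_field.
Set Implicit Arguments.
Unset Strict Implicit.
Unset Printing Implicit Defensive.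
Import GRing.Theory.
Local Open Scope classical_set_scope.
Local Open Scope ring_scope.

(** * Reduction of finitely generated subrings of a field to finite fields *)

Lemma finField_root_extension (F : finFieldType) (p : {poly F}) :
  (1 < size p)%N ->
  exists (L : finFieldType) (i : {rmorphism F -> L}) (b : L),
    root (map_poly i p) b.
Proof.
move=> p_gt1; have p_n0 : p != 0 by rewrite -size_poly_gt0 ltnW.
have [L [rs Dp _]] := FinSplittingFieldFor p_n0.
exists (FinFieldExtType L), (GRing.in_alg L); move/eqp_size: (Dp).
rewrite size_map_poly size_prod_XsubC => sz_p.
case: rs => [|b rs] in Dp sz_p; first by rewrite sz_p in p_gt1.
exists b; rewrite (eqp_root Dp b) root_prod_XsubC mem_head //.
Qed.

(* th stands for a homomorphism to F from the subring ev T of k; going through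
   the free object T keeps both maps total. *)
Definition specializable (T : idomainType) (k : fieldType)
    (ev : {rmorphism T -> k}) :=
  forall t, ev t != 0 -> exists (F : finFieldType) (th : {rmorphism T -> F}),
    (forall x, ev x = 0 -> th x = 0) /\ th t != 0.

(** In characteristic 0 the map [ev] is injective, so any prime above the absolute value of [t]
    gives a suitable reduction. *)
Lemma int_specializable (k : fieldType) (ev : {rmorphism int -> k}) :
  [pchar k] =i pred0 -> specializable ev.
Proof.
move=> char0 t; have evE x : ev x = x%:~R by rewrite -[x in LHS]intz rmorph_int.
have ev0 x : ev x = 0 -> x = 0.
  rewrite evE; case: x => x.
    by move/eqP; rewrite -pmulrn ((pcharf0P _).1 char0) => /eqP ->.
  rewrite NegzE mulrNz => /eqP; rewrite oppr_eq0 -pmulrn.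
  by rewrite ((pcharf0P _).1 char0).
move=> tN0; have [p t_ltp p_pr] := prime_above (absz t).
exists 'F_p, (intr : {rmorphism int -> 'F_p}); split=> [x /ev0 -> //|].
have t_gt0 : (0 < `|t|)%N.
  by rewrite absz_gt0; apply: contraNneq tN0 => ->; rewrite rmorph0.
have: (`|t|%N%:R : 'F_p) != 0.
  by rewrite -(dvdn_pcharf (pchar_Fp p_pr)) gtnNdvd.
case: (t) => x //; by rewrite NegzE rmorphN oppr_eq0.
Qed.

Section PolyTrunc.
Context (T : nzRingType) (k : fieldType) (ev : {rmorphism T -> k}).

Lemma size_map_poly_leq (q : {poly T}) : (size (map_poly ev q) <= size q)%N.
Proof. exact: size_poly. Qed.

(** Cutting off the top coefficients, which [ev] kills, does not change the image. *)
Lemma map_poly_trunc (q : {poly T}) : exists q' : {poly T},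
  map_poly ev q' = map_poly ev q /\ size q' = size (map_poly ev q).
Proof.
pose q' := take_poly (size (map_poly ev q)) q; exists q'.
have qq' : map_poly ev q' = map_poly ev q.
  apply/polyP=> i; rewrite !coef_map coef_take_poly.
  case: ltnP => // le_i.
  by rewrite -coef_map /= nth_default //; apply: rmorph0.
split=> //; apply/eqP; rewrite eqn_leq size_take_poly /= -qq'.
exact: size_map_poly_leq.
Qed.

End PolyTrunc.

Section AdjoinElement.
Context (T : idomainType) (k : fieldType) (ev : {rmorphism T -> k}) (a : k).

Definition adjoin_eval : {rmorphism {poly T} -> k} :=
  horner_eval a \o map_poly ev.

Lemma adjoin_evalE q : adjoin_eval q = (map_poly ev q).[a].
Proof. by []. Qed.

Lemma adjoin_evalC c : adjoin_eval c%:P = ev c.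
Proof. by rewrite adjoin_evalE map_polyC hornerC. Qed.

Lemma adjoin_evalX : adjoin_eval 'X = a.
Proof. by rewrite adjoin_evalE map_polyX hornerX. Qed.

Hypothesis ev_spec : specializable ev.

Lemma specializable_adjoin_free :
  (forall q, adjoin_eval q = 0 -> map_poly ev q = 0) ->
  specializable adjoin_eval.
Proof.
move=> free t tN0.
have [i ti_n0] : exists i, ev t`_i != 0.
  apply: contrapT => N; case/eqP: tN0; rewrite adjoin_evalE.
  suff -> : map_poly ev t = 0 by rewrite horner0.
  apply/polyP=> i; rewrite coef_map coef0; apply: contrapT => /eqP ti.
  by apply: N; exists i.
have [F [th [ker_th th_ti]]] := ev_spec ti_n0.
have tht_n0 : map_poly th t != 0.
  by apply: contraNneq th_ti => tht0; rewrite -coef_map tht0 coef0.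
(* The factor ['X] makes this polynomial nonconstant; at a root [b], the image of [t] takes a value
   whose product with [b] is -1, so this value is not 0. *)
have [|L [j [b]]] := @finField_root_extension F (map_poly th t * 'X + 1).
  by rewrite -[1]/(1%:P) size_MXaddC (negPf tht_n0) /= ltnS size_poly_gt0.
rewrite rootE rmorphD rmorphM /= map_polyX rmorph1 hornerD hornerM hornerX hornerC.
move=> /eqP rt.
exists L, (horner_eval b \o map_poly (j \o th)); split=> [q /free q0 |].
  rewrite /= /horner_eval (_ : map_poly _ q = 0) ?horner0 //.
  apply/polyP=> l; rewrite coef_map coef0 /= ker_th ?rmorph0 //.
  by rewrite -coef_map q0 coef0.
rewrite /= /horner_eval map_poly_comp; apply: contraPneq rt => ->.
by rewrite mul0r add0r; apply/eqP/oner_neq0.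
Qed.

(* p is a relation of minimal degree for a over ev T. By pseudo-division, the
   ideal (t, p) contains, modulo the kernel of ev, a constant c with ev c != 0: a
   map th that kills neither c nor lead_coef p extends by sending X to a root of
   the image of p, and t does not vanish there. *)
Lemma specializable_adjoin_algebraic (p : {poly T}) :
  adjoin_eval p = 0 -> size p = size (map_poly ev p) -> (0 < size p)%N ->
  (forall q, adjoin_eval q = 0 -> (size q < size p)%N -> map_poly ev q = 0) ->
  specializable adjoin_eval.
Proof.
move=> p0 sz_p p_gt0 min_p t tN0.
have p_n0 : p != 0 by rewrite -size_poly_gt0.
have e_n0 : ev (lead_coef p) != 0.
  by rewrite lead_coefE sz_p -coef_map lead_coef_eq0 -size_poly_gt0 -sz_p.
(* [comb] describes the ideal [(t, p)] modulo the kernel of [ev]; [w] below has least size among its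
   elements that do not vanish at [a]. *)
pose comb w := exists u v, map_poly ev w = map_poly ev (u * t + v * p).
have comb_t : comb t by exists 1, 0; rewrite mul1r mul0r addr0.
have adj_n0 w : adjoin_eval w != 0 -> map_poly ev w != 0.
  by apply: contraNneq => w0; rewrite adjoin_evalE w0 horner0.
have ex_w : exists m, `[< exists w, [/\ comb w, adjoin_eval w != 0 &
    size (map_poly ev w) = m] >].
  by exists (size (map_poly ev t)); apply/asboolP; exists t.
case: (ex_minnP ex_w) => m /asboolP [w0 [[u [v Dw]] w0N sz_w0]] min_w.
have [w [ww0 sz_w]] := map_poly_trunc ev w0.
have {}Dw : map_poly ev w = map_poly ev (u * t + v * p) by rewrite ww0.
have wN0 : adjoin_eval w != 0 by rewrite adjoin_evalE ww0.
have {}sz_w : size w = m by rewrite sz_w.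
have {}min_w r : comb r -> adjoin_eval r != 0 -> (size w <= size r)%N.
  move=> cr rN0; rewrite sz_w (leq_trans _ (size_map_poly_leq ev r)) //.
  by apply: min_w; apply/asboolP; exists r.
have mapE (x y : {poly T}) : map_poly ev (lead_coef x ^+ scalp y x *: y) =
    map_poly ev (y %/ x * x + y %% x) by rewrite Pdiv.Idomain.divp_eq.
(* The pseudo-remainder of [t] by [p] competes with [w]: at [a] it equals [t] times a power of the
   leading coefficient of [p]. *)
have w_lt_p : (size w < size p)%N.
  apply: leq_ltn_trans (min_w (t %% p) _ _) _;
    last by rewrite Pdiv.Idomain.ltn_modp.
    exists (lead_coef p ^+ scalp t p)%:P, (- (t %/ p)).
    by rewrite mul_polyC Pdiv.Idomain.divp_eq mulNr addrAC subrr add0r.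
  have -> : t %% p = lead_coef p ^+ scalp t p *: t - t %/ p * p.
    by rewrite Pdiv.Idomain.divp_eq addrAC subrr add0r.
  rewrite rmorphB rmorphM p0 mulr0 subr0 -mul_polyC rmorphM.
  by rewrite adjoin_evalC rmorphXn mulf_neq0 ?expf_neq0.
have w_n0 : w != 0 by apply: contraNneq wN0 => ->; rewrite rmorph0.
(* If [w] were nonconstant, [p %% w] would vanish at [a] by minimality of [w], hence be killed by
   [ev] by minimality of [p]. Then [p %/ w] would be a relation for [a] shorter than [p]. *)
have w_le1 : (size w <= 1)%N.
  rewrite leqNgt; apply/negP => w_gt1.
  have r0 : adjoin_eval (p %% w) = 0.
    apply: contrapT => /eqP rN0; suff: (size w <= size (p %% w)%R)%N.
      by rewrite leqNgt Pdiv.Idomain.ltn_modp w_n0.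
    apply: min_w rN0; exists (- (p %/ w) * u),
      ((lead_coef w ^+ scalp p w)%:P - p %/ w * v).
    have -> : p %% w = (lead_coef w ^+ scalp p w)%:P * p - p %/ w * w.
      by rewrite mul_polyC Pdiv.Idomain.divp_eq addrAC subrr add0r.
    rewrite !rmorphB !(rmorphM, rmorphD) /= Dw.
    rewrite !(rmorphM, rmorphD, rmorphN) /=.
    by rewrite mulrDr opprD mulrBl !mulNr !mulrA addrCA.
  have r_ev0 : map_poly ev (p %% w) = 0.
    by apply: min_p r0 _; rewrite (ltn_trans _ w_lt_p) // Pdiv.Idomain.ltn_modp.
  have := mapE w p; rewrite [in RHS]rmorphD /= r_ev0 addr0 -mul_polyC !rmorphM.
  rewrite /= map_polyC mul_polyC => Ds.
  have := congr1 (fun f => f.[a]) Ds; rewrite hornerZ hornerM -!adjoin_evalE.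
  rewrite p0 mulr0 => /esym/eqP; rewrite mulf_eq0 (negPf wN0) orbF => /eqP s0.
  have c_n0 : ev (lead_coef w ^+ scalp p w) != 0.
    rewrite rmorphXn expf_neq0 // lead_coefE -coef_map.
    suff -> : size w = size (map_poly ev w) by rewrite lead_coef_eq0 adj_n0.
    by rewrite ww0 sz_w.
  have evp_n0 : map_poly ev p != 0 by rewrite -size_poly_gt0 -sz_p.
  have evs_n0 : map_poly ev (p %/ w) != 0.
    apply: contraNneq evp_n0 => s00; move/eqP: Ds; rewrite s00 mul0r.
    by rewrite scaler_eq0 (negPf c_n0).
  have sz_s : (size (map_poly ev (p %/ w)) < size p)%N.
    rewrite sz_p -(size_scale (map_poly ev p) c_n0) Ds.
    rewrite (size_mul evs_n0 (adj_n0 _ wN0)) ww0 sz_w0 -sz_w.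
    move: w_gt1; case: (size w) => [|[|l]] // _.
    by rewrite addnS /= addnS ltnS leq_addr.
  have [s' [Ds' sz_s']] := map_poly_trunc ev (p %/ w).
  case/eqP: evs_n0; rewrite -Ds' min_p ?sz_s' //.
  by rewrite adjoin_evalE Ds'.
have {}w_le1 : w = (w`_0)%:P by apply: size1_polyC.
pose c := w`_0.
have cN0 : ev c != 0 by rewrite -adjoin_evalC -w_le1.
have [|F [th [ker_th th_ec]]] := ev_spec (_ : ev (lead_coef p * c) != 0).
  by rewrite rmorphM mulf_neq0.
have th_e : th (lead_coef p) != 0.
  by apply: contraNneq th_ec => e0; rewrite rmorphM e0 mul0r.
have th_c : th c != 0.
  by apply: contraNneq th_ec => e0; rewrite rmorphM e0 mulr0.
have p_gt1 : (1 < size p)%N.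
  rewrite ltnNge; apply/negP => /size1_polyC Dp.
  case/eqP: e_n0; rewrite -p0 Dp lead_coefC adjoin_evalC //.
have [|L [j [b]]] := @finField_root_extension F (map_poly th p).
  by rewrite size_map_poly_id0.
rewrite -map_poly_comp => /eqP pb0.
have ker_poly (x : {poly T}) : map_poly ev x = 0 -> map_poly th x = 0.
  move=> x0; apply/polyP=> i; rewrite coef_map coef0 /= ker_th //.
  by rewrite -coef_map x0 coef0.
pose H : {rmorphism {poly T} -> L} := horner_eval b \o map_poly (j \o th).
have HC x : H x%:P = j (th x) by rewrite /H /= map_polyC /horner_eval hornerC.
have H0 x : map_poly ev x = 0 -> H x = 0.
  by move/ker_poly; rewrite /H /= map_poly_comp => ->; rewrite rmorph0 rmorph0.
have Hp : H p = 0 by [].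
exists L, H; split=> [q q0|].
  (* Up to a power of the leading coefficient of [p], which [th] does not kill, [q] is a multiple of
     [p] plus a remainder; the remainder vanishes at [a], so [ev] kills it by minimality of [p]. *)
  have r0 : adjoin_eval (q %% p) = 0.
    have -> : q %% p = lead_coef p ^+ scalp q p *: q - q %/ p * p.
      by rewrite Pdiv.Idomain.divp_eq addrAC subrr add0r.
    by rewrite rmorphB rmorphM p0 mulr0 subr0 -mul_polyC rmorphM q0 mulr0.
  have /H0 Hr : map_poly ev (q %% p) = 0.
    by apply: min_p r0 _; rewrite Pdiv.Idomain.ltn_modp.
  have := congr1 H (Pdiv.Idomain.divp_eq q p).
  rewrite rmorphD rmorphM -mul_polyC rmorphM Hp Hr mulr0 addr0 HC.
  move/eqP; rewrite mulf_eq0 fmorph_eq0 rmorphXn expf_eq0 (negPf th_e) andbF.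
  by move/eqP.
have : H (w - (u * t + v * p)) = 0 by apply: H0; rewrite rmorphB /= Dw subrr.
rewrite rmorphB rmorphD !rmorphM Hp mulr0 addr0 w_le1 HC.
by apply: contra_eqN => /eqP ->; rewrite mulr0 subr0 fmorph_eq0.
Qed.

(** If [a] satisfies a nontrivial relation, one of least size keeps its leading coefficient under
    [ev], since truncation would otherwise shorten it. *)
Lemma specializable_adjoin : specializable adjoin_eval.
Proof.
have [free|] := pselect (forall q, adjoin_eval q = 0 -> map_poly ev q = 0).
  exact: specializable_adjoin_free.
move=> N; have ex_p : exists m, `[< exists q, [/\ adjoin_eval q = 0,
    map_poly ev q != 0 & size q = m] >].
  apply: contrapT => N2; apply: N => q q0; apply: contrapT => /eqP qN0.
  by apply: N2; exists (size q); apply/asboolP; exists q.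
case: (ex_minnP ex_p) => m /asboolP [p [p0 pN0 sz_p]] min_m.
have min_p q : adjoin_eval q = 0 -> (size q < size p)%N -> map_poly ev q = 0.
  move=> q0 lt_qp; apply: contrapT => /eqP qN0.
  suff: (m <= size q)%N by rewrite leqNgt -sz_p lt_qp.
  by apply: min_m; apply/asboolP; exists q.
suff sz_evp : size p = size (map_poly ev p).
  have p_gt0 : (0 < size p)%N by rewrite sz_evp size_poly_gt0.
  exact: specializable_adjoin_algebraic p0 sz_evp p_gt0 min_p.
have [p' [pp' sz_p']] := map_poly_trunc ev p.
apply/eqP; rewrite eqn_leq size_map_poly_leq andbT leqNgt -sz_p'.
apply/negP => /min_p; rewrite adjoin_evalE pp' => /(_ p0).
by apply/eqP.
Qed.

End AdjoinElement.

Section FiniteSpecialization.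
Variable k : fieldType.
Hypothesis char0 : [pchar k] =i pred0.

Lemma specializable_seq (cs : seq k) :
  exists (T : idomainType) (ev : {rmorphism T -> k}),
    specializable ev /\ forall c, c \in cs -> exists t, ev t = c.
Proof.
elim: cs => [|a cs [T [ev [ev_spec ev_onto]]]].
  by exists int, intr; split=> //; apply: int_specializable.
exists {poly T}, (adjoin_eval ev a); split=> [|c].
  exact: specializable_adjoin.
rewrite inE => /predU1P[-> | /ev_onto[t <-]].
  by exists 'X; apply: adjoin_evalX.
by exists t%:P; apply: adjoin_evalC.
Qed.

(** The inclusion of kernels makes [th] factor through the image of [ev], so that polynomial
    identities between the lifted elements persist in [F]. *)
Lemma finite_field_specialization (cs : seq k) :
  exists (T : comNzRingType) (F : finFieldType)
    (ev : {rmorphism T -> k}) (th : {rmorphism T -> F}),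
    (forall x, ev x = 0 -> th x = 0) /\
    forall c, c \in cs -> exists t, ev t = c.
Proof.
have [T [ev [ev_spec ev_onto]]] := specializable_seq cs.
have [|F [th [ker_th _]]] := ev_spec 1; first by rewrite rmorph1 oner_neq0.
by exists T, F, ev, th.
Qed.

End FiniteSpecialization.

(** * Generalities on ring morphisms and multivariate polynomials *)

Lemma rmorphism_inverse (R S : nzRingType) (f : {rmorphism R -> S}) :
  bijective f -> exists g : {rmorphism S -> R}, cancel f g /\ cancel g f.
Proof.
case=> g fK gK.
pose gA := GRing.isZmodMorphism.Build S R g (can2_zmod_morphism fK gK).
pose gM := GRing.isMonoidMorphism.Build S R g (can2_monoid_morphism fK gK).
pose G : {rmorphism S -> R} := HB.pack g gA gM.
by exists G.
Qed.

Lemma lrmorphism_of (k : fieldType) (B : comAlgType k) (f : {rmorphism B -> B}) :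
  scalable f -> exists g : {lrmorphism B -> B}, g =1 f.
Proof.
move=> fZ; pose fL := GRing.isScalable.Build k B B *:%R f fZ.
pose G : {lrmorphism B -> B} := HB.pack (f : B -> B) fL (GRing.RMorphism.class f).
by exists G.
Qed.

Section MPolyGeneral.
Context (n : nat).

Lemma mpoly_ring_ind (R : nzRingType) (P : {mpoly R[n]} -> Prop) :
  (forall c, P c%:MP) -> (forall i, P 'X_i) ->
  (forall p q, P p -> P q -> P (p + q)) ->
  (forall p q, P p -> P q -> P (p * q)) -> forall p, P p.
Proof.
move=> PC PX PD PM; elim/mpolyind => [|c m p _ _ Pp]; first exact: (PC 0).
apply: (PD) => //; rewrite -mul_mpolyC; apply: (PM); first exact: PC.
rewrite mpolyXE_id; elim/big_rec: _ => [|i x _ Px]; first exact: (PC 1).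
apply: (PM) => //; elim: (m i) => [|e IH]; first exact: (PC 1).
by rewrite exprS; apply: (PM).
Qed.

Lemma msize_sum_leq (R : nzRingType) (I : Type) (r : seq I) (P : pred I)
    (F : I -> {mpoly R[n]}) d :
  (forall i, P i -> (msize (F i) <= d)%N) ->
  (msize (\sum_(i <- r | P i) F i) <= d)%N.
Proof.
move=> Fd; elim/big_rec: _ => [|i x Pi xd]; first by rewrite msize0.
by rewrite (leq_trans (msizeD_le _ _)) // geq_max Fd.
Qed.

Lemma msize_image_bounded (k : fieldType) (m p : nat)
    (f : {linear {mpoly k[m]} -> {mpoly k[n]}}) :
  exists d, forall P, (msize P <= p)%N -> (msize (f P) <= d)%N.
Proof.
exists (\max_(e : 'X_{1..m < p}) msize (f 'X_[e])) => P Pp.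
rewrite (mpolywE Pp) linear_sum; apply: msize_sum_leq => e _.
by rewrite linearZ (leq_trans (mmeasureZ_le _ _ _)) // leq_bigmax.
Qed.

End MPolyGeneral.

(** * Kernel and preimages of a simple derivation *)

Section SimpleDerivation.
Context (k : fieldType) (n : nat).
Notation A := {mpoly k[n]}.
Context (D : {linear A -> A}).
Hypothesis (D_der : leibniz D) (D_simple : simple D).

Lemma derivation1 : D 1 = 0.
Proof.
by apply/(@addrI _ (D 1)); rewrite -[in RHS](mul1r 1) D_der mulr1 mul1r addr0.
Qed.

Lemma derivationC c : D c%:MP = 0.
Proof. by rewrite -alg_mpolyC linearZ /= derivation1 scaler0. Qed.

(** The principal ideal of such an [f] is [D]-stable, so [f] is zero or a unit, and units are
    constants. *)
Lemma simple_kernel f : D f = 0 -> f = (f@_0)%:MP.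
Proof.
move=> Df0; have [->|fN0] := eqVneq f 0; first by rewrite mcoeff0.
case: (D_simple (I := [set g | exists h, g = h * f])).
- split=> [|x y [u ->] [v ->]|x y [u ->]]; first by exists 0; rewrite mul0r.
    by exists (u + v); rewrite mulrDl.
  by exists (x * u); rewrite mulrA.
- by move=> _ [h ->]; exists (D h); rewrite D_der Df0 mulr0 addr0.
- move=> I0; have : [set g | exists h, g = h * f] f by exists 1; rewrite mul1r.
  by rewrite I0 => /eqP; rewrite (negPf fN0).
move=> IT; have : [set g | exists h, g = h * f] 1 by rewrite IT.
by case=> h /esym /mpoly_intro_unit /andP[/eqP].
Qed.

(** The kernel of [D] is made of constants, and each monomial spanning the target enlarges the
    preimage by at most one dimension. *)
Lemma derivation_preimage_bounded d :
  exists d', forall f, (msize (D f) <= d)%N -> (msize f <= d')%N.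
Proof.
pose span := fix span (es : seq A) (w : A) : Prop :=
  if es is e :: es' then exists c : k, span es' (w - c *: e) else w = 0.
have spanB es x y c : span es x -> span es y -> span es (x - c *: y).
  elim: es x y => [|e es IH] x y /=; first by move=> -> ->; rewrite scaler0 subr0.
  move=> [a xa] [b yb]; exists (a - c * b).
  have -> : x - c *: y - (a - c * b) *: e = (x - a *: e) - c *: (y - b *: e).
    rewrite scalerBl scalerBr scalerA !opprB addrACA [RHS]addrACA.
    by rewrite [- _ - _]addrC.
  exact: IH.
have bounded es : exists d', forall f, span es (D f) -> (msize f <= d')%N.
  elim: es => [|e es [d' IH]].
    by exists 1%N => f /simple_kernel ->; rewrite msizeC; case: (_ != _).
  (* If some [f0] has an image that involves [e], subtracting multiples of [f0] brings every other
     [f] back to the span of [es]. *)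
  have [[f0 [c [c0 sp0]]]|N] := pselect (exists f0 c, c != 0 /\
    span es (D f0 - c *: e)); last first.
    exists d' => f [c spf]; apply: IH; have [c0|c0] := eqVneq c 0.
      by move: spf; rewrite c0 scale0r subr0.
    by case: N; exists f, c.
  exists (maxn d' (msize f0)) => f [a spf].
  pose b := a / c; have -> : f = (f - b *: f0) + b *: f0 by rewrite subrK.
  rewrite (leq_trans (msizeD_le _ _)) // geq_max !leq_max IH /=; last first.
    have -> : D (f - b *: f0) = (D f - a *: e) - b *: (D f0 - c *: e).
      rewrite linearB linearZ /= scalerBr scalerA divfK // opprB addrA.
      by rewrite subrK.
    exact: spanB.
  by rewrite mmeasureZ_le orbT.
have [d' Hd'] := bounded [seq 'X_[val m] | m <- enum {: 'X_{1..n < d}}].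
exists d' => f /mpolywE Df; apply: Hd'; rewrite Df -big_enum /=.
elim: (enum _) => [|m s IH] /=; first by rewrite big_nil.
by exists (D f)@_(val m); rewrite big_cons addrAC subrr add0r.
Qed.

End SimpleDerivation.

(** * Taylor expansion and invariants of translations *)

Section Taylor.
Context (k : fieldType) (B : comAlgType k) (s : nat).

Lemma translationD a : {morph @translation k s B a : F G / F + G}.
Proof. by move=> F G; rewrite /translation raddfD. Qed.

Lemma translationM a : {morph @translation k s B a : F G / F * G}.
Proof. by move=> F G; rewrite /translation rmorphM. Qed.

Lemma translationC a b : @translation k s B a b%:MP = b%:MP.
Proof. exact: comp_mpolyC. Qed.

Lemma translationX a j :
  @translation k s B a 'X_j = 'X_j + ((a 0 j)%:A)%:MP.
Proof. by rewrite /translation comp_mpolyXU -tnth_nth tnth_mktuple. Qed.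

(** [q] is the Taylor expansion of [F] in the direction [i], with the length of the translation as
    its variable. *)
Lemma translation_taylor (i : 'I_s) (F : {mpoly B[s]}) :
  exists q : {poly {mpoly B[s]}},
    [/\ forall c : k, q.[(c%:A)%:MP] = translation (c *: delta_mx 0 i) F,
        q`_0 = F & q`_1 = F^`M(i)].
Proof.
elim/mpoly_ring_ind: F => [b|j|F G [q [qT q0 q1]] [r [rT r0 r1]]|
    F G [q [qT q0 q1]] [r [rT r0 r1]]].
- exists (b%:MP)%:P; split=> [c||]; last by rewrite coefC mderivC.
    by rewrite hornerC translationC.
  by rewrite coefC.
- exists (('X_j)%:P + (j == i)%:R *: 'X); split=> [c||].
  + rewrite hornerD hornerC hornerZ hornerX translationX !mxE eqxx /=.
    by case: (j == i); rewrite ?mulr1 ?mulr0 ?mul1r ?mul0r ?scale0r ?mpolyC0.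
  + by rewrite coefD coefC coefZ coefX mulr0 addr0.
  + rewrite coefD coefC coefZ coefX add0r mulr1 mderivX mnm1E.
    case: eqVneq => [->|]; last by rewrite scale0r.
    by rewrite scale1r -[LHS]mpolyX0; congr 'X_[_]; apply/mnmP=> l;
      rewrite mnmBE subnn mnm0E.
- exists (q + r); split=> [c||]; last by rewrite coefD q1 r1 mderivD.
    by rewrite hornerD qT rT translationD.
  by rewrite coefD q0 r0.
exists (q * r); split=> [c||].
- by rewrite hornerM qT rT translationM.
- by rewrite coef0M q0 r0.
by rewrite coefM !big_ord_recl big_ord0 /= addr0 subn0 subnn
  q0 q1 r0 r1 mderivM addrC.
Qed.

End Taylor.

Lemma autDV (k : fieldType) (B : comAlgType k) (m : nat)
    (emb : {lrmorphism {mpoly k[m]} -> B}) (D : B -> B) (phi : aut emb) :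
  autD emb D phi -> autD emb D (phi^-1)%g.
Proof.
by move=> phiD f; apply: (can_inj (aut_funK phi)); rewrite phiD /= !aut_invK.
Qed.

Lemma poly_nat_roots (R : idomainType) (q : {poly R}) :
  [pchar R] =i pred0 -> (forall m, q.[m%:R] = 0) -> q = 0.
Proof.
move=> char0 q0; apply: contrapT => /eqP qN0.
have le_inj i j : (i <= j)%N -> i%:R = j%:R :> R -> i = j.
  move=> le_ij /esym/eqP; rewrite -subr_eq0 -natrB // ((pcharf0P _).1 char0).
  by rewrite subn_eq0 => le_ji; apply/eqP; rewrite eqn_leq le_ij.
have inj : injective (fun m : nat => m%:R : R).
  move=> i j e; case/orP: (leq_total i j) => [le_ij|le_ji]; first exact: le_inj.
  by apply/esym/le_inj.
have := max_poly_roots (rs := [seq m%:R | m <- iota 0 (size q)]) qN0.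
rewrite size_map size_iota ltnn map_inj_uniq ?iota_uniq // => N.
suff: false by []; apply: N => //; apply/allP => _ /mapP[m _ ->].
by rewrite rootE q0.
Qed.

Section Invariants.
Context (k : fieldType) (char0 : [pchar k] =i pred0) (B : comAlgType k).
Context (s : nat).

Lemma mderiv_eq0_const (F : {mpoly B[s]}) :
  (forall i, F^`M(i) = 0) -> F = (F@_0)%:MP.
Proof.
move=> dF; apply/mpolyP=> m; rewrite mcoeffC.
case: eqVneq => [<-|mN0]; first by rewrite mulr1.
have [i mi] : exists i, m i != 0%N.
  apply: contrapT => N; case/eqP: mN0; apply/mnmP => i; rewrite mnm0E.
  by apply: contrapT => /eqP mi; apply: N; exists i.
have := congr1 (mcoeff (m - U_(i))%MM) (dF i); rewrite mcoeff0 mcoeff_deriv.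
rewrite submK; last first.
  by apply/mnm_lepP => j; rewrite mnm1E; case: eqP => // <-; rewrite lt0n.
rewrite mulr0 -scaler_nat => /eqP; rewrite scaler_eq0.
by rewrite ((pcharf0P _).1 char0) orFb => /eqP.
Qed.

(** The Taylor polynomials take the constant value [F] at all natural numbers, so they are constant
    and the partial derivatives of [F] vanish. Roots are counted after transport by the inverse of
    [Psi], because [{mpoly k[n]}] is known to be a domain. *)
Lemma translation_invariant_const (n : nat)
    (Psi : {rmorphism {mpoly k[n]} -> {mpoly B[s]}}) (F : {mpoly B[s]}) :
  bijective Psi -> (forall c : k, Psi c%:MP = (c%:A)%:MP) ->
  (forall a, translation a F = F) -> F = (F@_0)%:MP.
Proof.
move=> /rmorphism_inverse [PsiI [PsiK PsiIK]] PsiC F_inv.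
apply: mderiv_eq0_const => i; have [q [qT q0 q1]] := translation_taylor i F.
apply: (can_inj PsiIK); rewrite rmorph0 -q1.
have q_const : map_poly PsiI q = (PsiI F)%:P.
  apply/eqP; rewrite -subr_eq0; apply/eqP.
  apply: poly_nat_roots => [p|m]; first by rewrite pchar_lalg char0.
  have -> : m%:R = PsiI ((m%:R : k)%:A)%:MP by rewrite -PsiC PsiK mpolyC_nat.
  by rewrite hornerD hornerN hornerC horner_map /= qT F_inv subrr.
by rewrite -(coef_map PsiI q 1) q_const coefC.
Qed.

End Invariants.

(** * Bounded degree of the orbits of [Aut(D)] *)

Section Boundedness.
Context (k : fieldType) (char0 : [pchar k] =i pred0) (n : nat).
Notation A := {mpoly k[n]}.
Context (D : {linear A -> A}).
Hypothesis (D_der : leibniz D) (D_simple : simple D).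

Definition orbit_bounded (f : A) :=
  exists d, forall phi, autD (affine_emb k n) D phi -> (msize (phi f) <= d)%N.

Lemma orbit_boundedC c : orbit_bounded c%:MP.
Proof.
exists 1%N => phi _; rewrite -alg_mpolyC linearZ /= rmorph1 alg_mpolyC msizeC.
by case: (_ != _).
Qed.

Lemma orbit_boundedD f g :
  orbit_bounded f -> orbit_bounded g -> orbit_bounded (f + g).
Proof.
move=> [d fd] [e ge]; exists (maxn d e) => phi phiD; rewrite rmorphD.
by rewrite (leq_trans (msizeD_le _ _)) // geq_max !leq_max fd // ge // orbT.
Qed.

Lemma orbit_boundedM f g :
  orbit_bounded f -> orbit_bounded g -> orbit_bounded (f * g).
Proof.
move=> [d fd] [e ge]; exists (d + e).+1 => phi phiD; rewrite rmorphM.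
by rewrite (leq_trans (msizeM_le _ _)) // ltnS leq_add ?fd ?ge.
Qed.

Lemma orbit_bounded_primitive f : orbit_bounded (D f) -> orbit_bounded f.
Proof.
move=> [d Dfd]; have [d' Hd'] := derivation_preimage_bounded D_der D_simple d.
by exists d' => phi phiD; apply: Hd'; rewrite -phiD Dfd.
Qed.

Section Trivialization.
Context (s : nat) (H : set (autA k n)).
Hypothesis (H_normal : normal_subgroup (autD (affine_emb k n) D) H).
Context (h : 'rV[k]_s -> autA k n) (h_iso : isomorphic_Ga H h).
Context (B : comAlgType k) (m : nat) (emb : {lrmorphism {mpoly k[m]} -> B}).
Hypothesis emb_closed : closed_embedding emb.
Context (Psi : {rmorphism A -> {mpoly B[s]}}).
Hypothesis Psi_triv : equivariant_trivialization h Psi.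
Context (Dbar : B -> B) (Dbar_restr : is_restriction Psi D Dbar).

Lemma orbit_bounded_trivialization p :
  autD emb Dbar `<=` aut_piece p -> forall f, orbit_bounded f.
Proof.
move=> autDbar_p; have [Psi_bij PsiC PsiT] := Psi_triv.
have [PsiI [PsiK PsiIK]] := rmorphism_inverse Psi_bij.
have [hD h_inj h_im] := h_iso; have [H_sub H1 HM HV H_conj] := H_normal.
pose iota : {rmorphism B -> A} := PsiI \o @mpolyC s B.
have iota_inj : injective iota.
  by apply: inj_comp (can_inj PsiIK) (can_inj (@mpolyCK _ _)).
have PsiI_iota b : PsiI b%:MP = iota b by [].
have Psi_iota b : Psi (iota b) = b%:MP by rewrite PsiIK.
have iotaC (c : k) : iota c%:A = c%:MP by rewrite /iota /= -PsiC PsiK.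
have iotaZ c b : iota (c *: b) = c *: iota b.
  by rewrite -mul_mpolyC -iotaC -rmorphM mulr_algl.
have h_autD a : autD (affine_emb k n) D (h a).
  by apply: H_sub; rewrite -h_im; exists a.
have h_iota a b : h a (iota b) = iota b.
  by apply: (can_inj PsiK); rewrite PsiT Psi_iota translationC.
have invariant f : (forall a, h a f = f) -> exists b, f = iota b.
  move=> hf; exists ((Psi f)@_0); apply: (can_inj PsiK); rewrite Psi_iota.
  apply: (translation_invariant_const char0 Psi_bij PsiC) => a.
  by rewrite -PsiT hf.
have D_iota b : D (iota b) = iota (Dbar b).
  by apply: (can_inj PsiK); rewrite Psi_iota; apply: Dbar_restr.
have phi_iota phi b : autD (affine_emb k n) D phi ->
    exists b', phi (iota b) = iota b'.
  (* By normality the conjugate of [h a] by the inverse of [phi] is some [h a'], which fixes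
     [iota b]; hence [h a] fixes [phi (iota b)]. *)
  move=> phiD; apply: invariant => a.
  have phiVD := autDV phiD.
  have Hha : H (h a) by rewrite -h_im; exists a.
  have := H_conj _ _ phiVD Hha; rewrite -h_im => -[a' _].
  rewrite invgK => /(congr1 (fun g : autA k n => phi (g (iota b)))) /=.
  by rewrite h_iota aut_invK.
have iota_bounded b : orbit_bounded (iota b).
  (* The constant coefficient makes [restr] total; nothing is lost for [phi] in [Aut(D)], which maps
     the image of [iota] into itself. *)
  pose restr (phi : autA k n) : {rmorphism B -> B} :=
    mcoeff 0%MM \o Psi \o phi \o iota.
  have restrE phi c : autD (affine_emb k n) D phi ->
      phi (iota c) = iota (restr phi c).
    move=> /phi_iota-/(_ c)[c' E].
    by rewrite /restr /= E Psi_iota mcoeffC eqxx mulr1.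
  have restr_lin phi : autD (affine_emb k n) D phi ->
      exists g : {lrmorphism B -> B}, g =1 restr phi.
    move=> phiD; apply: lrmorphism_of => c x; apply: iota_inj.
    by rewrite [RHS]iotaZ -!restrE // iotaZ linearZ.
  have restr_aut phi : autD (affine_emb k n) D phi ->
      exists2 g : aut emb, autD emb Dbar g & forall c, phi (iota c) = iota (g c).
    move=> phiD; have phiVD := autDV phiD.
    have [g gE] := restr_lin _ phiD; have [g' g'E] := restr_lin _ phiVD.
    have gK : cancel g g'.
      move=> c; apply: iota_inj; rewrite gE g'E -restrE // -restrE //=.
      by rewrite aut_funK.
    have g'K : cancel g' g.
      move=> c; apply: iota_inj; rewrite gE g'E -restrE // -restrE //=.
      by rewrite aut_invK.
    exists (@Aut _ _ _ emb g g' gK g'K) => [c|c] /=; last by rewrite gE restrE.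
    by apply: iota_inj; rewrite -D_iota !gE -!restrE // -phiD D_iota.
  (* This map is linear, so it turns a bound on the degree with respect to [emb] into a bound on the
     degree in [A]. *)
  pose iemb : {rmorphism {mpoly k[m]} -> A} := iota \o emb.
  have iembZ : scalable iemb.
    by move=> c x; rewrite [LHS](congr1 iota (linearZ_LR emb c x)) iotaZ.
  pose iembA := GRing.isScalable.Build k {mpoly k[m]} A *:%R iemb iembZ.
  pose iembL : {linear {mpoly k[m]} -> A} :=
    HB.pack (iemb : _ -> _) iembA (GRing.RMorphism.class iemb).
  have [d iembd] := msize_image_bounded p.+1 iembL.
  have [P <-] := emb_closed b; elim/mpoly_ring_ind: P => [c|i|P Q HP HQ|P Q HP HQ].
  - rewrite -alg_mpolyC (linearZ_LR emb) rmorph1 iotaC; apply: orbit_boundedC.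
  - exists d => phi /restr_aut[g gD phig]; rewrite phig.
    by have [P Pp <-] := autDbar_p _ gD i; apply: iembd.
  - by rewrite !rmorphD; apply: orbit_boundedD.
  by rewrite !rmorphM; apply: orbit_boundedM.
move=> f; rewrite -(PsiK f).
elim/mpoly_ring_ind: (Psi f) => [b|j|F G HF HG|F G HF HG].
- exact: iota_bounded.
- apply: orbit_bounded_primitive.
  suff [b ->] : exists b, D (PsiI 'X_j) = iota b by [].
  apply: invariant => a; rewrite h_autD.
  have -> : h a (PsiI 'X_j) = PsiI 'X_j + (a 0 j)%:MP.
    by apply: (can_inj PsiK); rewrite PsiT rmorphD PsiIK PsiC translationX.
  by rewrite linearD /= (derivationC D_der) addr0.
- by rewrite rmorphD; apply: orbit_boundedD.
by rewrite rmorphM; apply: orbit_boundedM.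
Qed.

End Trivialization.
End Boundedness.

(** * Closedness of [Aut(D)] *)

Section Closedness.
Context (k : fieldType) (n : nat).
Notation A := {mpoly k[n]}.
Implicit Types (P : 'I_n -> A).

Lemma lrmorphism_comp_mpoly (f : {lrmorphism A -> A}) Q :
  f Q = Q \mPo [tuple f 'X_i | i < n].
Proof.
elim/mpoly_ring_ind: Q => [c|i|p q IHp IHq|p q IHp IHq].
- by rewrite comp_mpolyC -alg_mpolyC linearZ /= rmorph1.
- by rewrite comp_mpolyXU -tnth_nth tnth_mktuple.
- by rewrite !rmorphD /= IHp IHq.
by rewrite !rmorphM /= IHp IHq.
Qed.

Lemma commute_derivation_gens (D : {linear A -> A}) (f : {lrmorphism A -> A}) :
  leibniz D -> (forall i, f (D 'X_i) = D (f 'X_i)) -> forall b, f (D b) = D (f b).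
Proof.
move=> D_der fD b; elim/mpoly_ring_ind: b => [c|i|p q IHp IHq|p q IHp IHq].
- rewrite (derivationC D_der) -alg_mpolyC linearZ /= !rmorph1 rmorph0.
  by rewrite alg_mpolyC (derivationC D_der).
- exact: fD.
- by rewrite linearD /= !rmorphD /= linearD /= IHp IHq.
by rewrite D_der rmorphD !rmorphM /= D_der IHp IHq.
Qed.

Section CoordinateFunctions.
Context (p : nat).
Notation N := #|coord_index n p|.

(* E is the value of f at the tuple with indeterminate coefficients. *)
Definition coord_polynomial (f : ('I_n -> A) -> A) :=
  exists E : {mpoly {mpoly k[N]}[n]}, forall P,
    (forall i, (msize (P i) <= p.+1)%N) -> map_mpoly (meval (coords P)) E = f P.

Lemma coord_polynomial_cst c : coord_polynomial (fun=> c).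
Proof.
exists (map_mpoly (@mpolyC N k) c) => P _; apply/mpolyP => m.
by rewrite !mcoeff_map_mpoly /= mevalC.
Qed.

Lemma coord_polynomialB f g : coord_polynomial f -> coord_polynomial g ->
  coord_polynomial (fun P => f P - g P).
Proof.
by move=> [E fE] [F gF]; exists (E - F) => P Pp; rewrite raddfB /= fE ?gF.
Qed.

Lemma coord_polynomial_linear (L : {linear A -> A}) i :
  coord_polynomial (fun P => L (P i)).
Proof.
exists (\sum_(m : 'X_{1..n < p.+1})
  'X_(enum_rank ((i, m) : coord_index n p)) *: map_mpoly (@mpolyC N k) (L 'X_[m])).
move=> P Pp; rewrite (mpolywE (Pp i)) [LHS]raddf_sum [RHS]linear_sum.
apply: eq_bigr => m _.

rewrite /= map_mpolyZ linearZ /= mevalXU /coords enum_rankK /=; congr (_ *: _).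
by apply/mpolyP => e; rewrite !mcoeff_map_mpoly /= mevalC.
Qed.

Lemma coord_polynomial_comp Q :
  coord_polynomial (fun P => Q \mPo [tuple P i | i < n]).
Proof.
elim/mpoly_ring_ind: Q => [c|i|q r [E HE] [F HF]|q r [E HE] [F HF]].
- have [E HE] := coord_polynomial_cst c%:MP.
  by exists E => P Pp; rewrite HE // comp_mpolyC.
- have [E HE] := coord_polynomial_linear idfun i.
  by exists E => P Pp; rewrite HE // comp_mpolyXU -tnth_nth tnth_mktuple.
- by exists (E + F) => P Pp; rewrite raddfD /= HE ?HF // raddfD.
by exists (E * F) => P Pp; rewrite rmorphM /= HE ?HF // rmorphM.
Qed.

End CoordinateFunctions.

(** Commutation with [D] need only be tested on the variables, where the coefficients of the
    difference of both sides are polynomials in the coefficients of the [phi 'X_i]. *)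
Lemma autD_closed (D : {linear A -> A}) :
  leibniz D -> closed (autD (affine_emb k n) D).
Proof.
move=> D_der; apply/closed_autE => p.
have /choice [E HE] i : exists E : {mpoly {mpoly k[#|coord_index n p|]}[n]},
    forall P, (forall i, (msize (P i) <= p.+1)%N) ->
    map_mpoly (meval (coords P)) E =
      (D 'X_i) \mPo [tuple P j | j < n] - D (P i).
  apply: coord_polynomialB; first exact: coord_polynomial_comp.
  exact: coord_polynomial_linear.
exists [set q | exists i m, q = (E i)@_m] => phi P Pp Pphi.
have PE i : P i = phi 'X_i := Pphi i.
have PhiE Q : Q \mPo [tuple P j | j < n] = phi Q.
  rewrite [RHS]lrmorphism_comp_mpoly; congr (_ \mPo _).
  by apply: eq_from_tnth => i; rewrite !tnth_mktuple; apply: PE.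
split=> [phiD q [i [m ->]]|E0].
  by rewrite -mcoeff_map_mpoly HE // PhiE PE phiD subrr mcoeff0.
apply: (commute_derivation_gens (f := phi) D_der) => i.
apply/eqP; rewrite -subr_eq0; apply/eqP.
rewrite -PhiE -PE -HE //; apply/mpolyP => m.
by rewrite mcoeff_map_mpoly mcoeff0; apply: E0; exists i, m.
Qed.

End Closedness.

(** * Powers of a unipotent automorphism form a connected set *)

Section UnipotentOrbit.
Context (k : fieldType) (char0 : [pchar k] =i pred0).

Definition binomial_poly (j : nat) : {poly k} :=
  (j`!%:R)^-1 *: \prod_(l < j) ('X - l%:R%:P).

Lemma binomial_polyE j m : (binomial_poly j).[m%:R] = 'C(m, j)%:R.
Proof.
have fact_n0 : j`!%:R != 0 :> k.
  by rewrite ((pcharf0P _).1 char0) -lt0n fact_gt0.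
suff E : (\prod_(l < j) ('X - l%:R%:P) : {poly k}).[m%:R] = (m ^_ j)%:R.
  by rewrite /binomial_poly hornerZ E -bin_ffact natrM mulrC mulfK.
elim: j {fact_n0} => [|j IH]; first by rewrite big_ord0 hornerE.
rewrite big_ord_recr hornerM IH ffactnSr natrM /= hornerXsubC.
have [le_jm|lt_mj] := leqP j m; first by rewrite natrB.
by rewrite ffact_small // !mul0r.
Qed.

(** This is Newton's forward difference formula, [d j] being the [j]-th difference; Pascal's rule
    gives the induction step. *)
Lemma iter_newton (A : zmodType) (L : {additive A -> A}) (d : nat -> A) N m :
  (forall j, L (d j) = d j + d j.+1) -> d N.+1 = 0 ->
  iter m L (d 0%N) = \sum_(j < N.+1) d j *+ 'C(m, j).
Proof.
move=> LE dN; elim: m => [|m IH].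
  by rewrite big_ord_recl bin0 mulr1n big1 ?addr0 // => j _; rewrite bin0n.
rewrite iterS IH raddf_sum.
have -> : \sum_(j < N.+1) L (d j *+ 'C(m, j)) =
    \sum_(j < N.+1) (d j *+ 'C(m, j) + d j.+1 *+ 'C(m, j)).
  by apply: eq_bigr => j _; rewrite raddfMn -mulrnDl -LE.
rewrite big_split /= [X in X + _]big_ord_recl [X in _ + X]big_ord_recr /=.
rewrite dN mul0rn addr0 [RHS]big_ord_recl /= !bin0 -addrA -big_split /=.
by congr (_ + _); apply: eq_bigr => j _; rewrite binS mulrnDr.
Qed.

(** The Newton expansion is finite because [L - 1] is nilpotent on [v], and in characteristic 0 its
    binomial coefficients are polynomials in [m]. *)
Lemma iter_polynomial (A : comAlgType k) (L : {linear A -> A}) (v : A) N :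
  iter N (fun x => L x - x) v = 0 ->
  exists P : {poly A}, forall m, iter m L v = P.[m%:R].
Proof.
pose d j := iter j (fun x => L x - x) v => dN.
have LE j : L (d j) = d j + d j.+1 by rewrite addrC subrK.
have dN1 : d N.+1 = 0 by rewrite /d iterS dN linear0 subr0.
exists (\sum_(j < N.+1) d j *: map_poly (GRing.in_alg A) (binomial_poly j)).
move=> m; rewrite -[v]/(d 0%N) (iter_newton _ LE dN1) horner_sum.
apply: eq_bigr => j _.
rewrite hornerZ -(rmorph_nat (GRing.in_alg A)) horner_map binomial_polyE.
by rewrite rmorph_nat mulr_natr.
Qed.

Section CyclicConnected.
Context (n : nat).
Notation A := {mpoly k[n]}.

Lemma mcoeff_horner_nat (q : {poly A}) e m :
  (q.[m%:R])@_e = (map_poly (mcoeff e) q).[m%:R].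
Proof.
rewrite horner_coef raddf_sum (horner_coef_wide _ (size_poly _ _)).
apply: eq_bigr => i _; rewrite coef_map /= -!natrX !mulr_natr.
exact: mcoeffMn.
Qed.

Lemma meval_horner (N : nat) (c : 'I_N -> {poly k}) (q : {mpoly k[N]}) :
  exists r : {poly k}, forall x, r.[x] = q.@[fun j => (c j).[x]].
Proof.
elim/mpoly_ring_ind: q => [a|i|p q [r rE] [t tE]|p q [r rE] [t tE]].
- by exists a%:P => x; rewrite hornerC mevalC.
- by exists (c i) => x; rewrite mevalXU.
- by exists (r + t) => x; rewrite hornerD rE tE mevalD.
by exists (r * t) => x; rewrite hornerM rE tE mevalM.
Qed.

Context (g : autA k n) (P : 'I_n -> {poly A}) (p : nat).
Hypothesis g_poly : forall m i, (g ^+ m)%g 'X_i = (P i).[m%:R].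
Hypothesis g_piece : forall m, aut_piece p (g ^+ m)%g.

(** Pulled back along the powers of [g], each equation of [C] becomes a polynomial in the exponent:
    either all of them vanish at every natural number, or one of them is nonzero. *)
Lemma closed_powers_dichotomy (C : set (autA k n)) : closed C ->
  (forall m, C (g ^+ m)%g) \/
  exists2 r : {poly k}, r != 0 & forall m, C (g ^+ m)%g -> r.[m%:R] = 0.
Proof.
move=> /closed_autE/(_ p)[S CS].
pose c (j : 'I_#|coord_index n p|) :=
  map_poly (mcoeff (val (enum_val j).2)) (P (enum_val j).1).
have cE m : coords (fun i => (g ^+ m)%g 'X_i) =1 fun j => (c j).[m%:R].
  by move=> j; rewrite /coords g_poly mcoeff_horner_nat.
have {}CS m : C (g ^+ m)%g <->
    forall q, S q -> q.@[fun j => (c j).[m%:R]] = 0.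
  rewrite -(funext (cE m)).
  apply: CS => // i; exact: (aut_piece_affineE p (g ^+ m)%g).1.
have [vanish|] := pselect (forall q, S q -> forall m,
    q.@[fun j => (c j).[m%:R]] = 0).
  by left=> m; apply/CS => q Sq; apply: vanish.
move=> nv; right; have [q [Sq [m qm]]] : exists q, S q /\ exists m,
    q.@[fun j => (c j).[m%:R]] <> 0.
  apply: contrapT => N; apply: nv => q Sq m; apply: contrapT => qm.
  by apply: N; exists q; split=> //; exists m.
have [r rE] := meval_horner c q; exists r => [|l /CS/(_ _ Sq)]; last by rewrite rE.
by apply: contra_notN qm => /eqP r0; rewrite -rE r0 horner0.
Qed.

(** As for the irreducibility of a line: if neither [C] nor the complement of [U] contained all
    powers, two nonzero polynomials would have a product that vanishes at every natural number. *)
Lemma connected_powers : connected (range (fun m => (g ^+ m)%g)).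
Proof.
move=> Z [z Zz] [U Uo ZU] [C Cc ZC].
have UCc : closed (~` U) by rewrite closedC.
have [Call|[r r0 rC]] := closed_powers_dichotomy Cc.
  by rewrite ZC; apply/setIidl => _ [m _ <-].
have [NUall|[t t0 tU]] := closed_powers_dichotomy UCc.
  by move: Zz; rewrite ZU => -[[m _ <-]] /NUall.
have : r * t = 0.
  apply: poly_nat_roots => // m; rewrite hornerM.
  have [gU|gNU] := pselect (U (g ^+ m)%g); last by rewrite tU ?mulr0.
  have : Z (g ^+ m)%g by rewrite ZU; split=> //; exists m.
  by rewrite ZC => -[_ /rC ->]; rewrite mul0r.
by move/eqP; rewrite mulf_eq0 (negPf r0) (negPf t0).
Qed.

End CyclicConnected.
End UnipotentOrbit.

(** * Generalized eigenspaces of an algebra endomorphism *)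

Section WeightSpaces.
Context (k : fieldType) (A : comAlgType k) (g : {lrmorphism A -> A}).

(* Weight vectors are generalized eigenvectors: (g - l)^N v = 0. *)
Fixpoint weight_vector_at (l : k) (N : nat) (v : A) : Prop :=
  if N is N'.+1 then weight_vector_at l N' (g v - l *: v) else v = 0.

Definition weight_vector (l : k) (v : A) := exists N, weight_vector_at l N v.

Lemma weight_vector_atD l N u v : weight_vector_at l N u ->
  weight_vector_at l N v -> weight_vector_at l N (u + v).
Proof.
elim: N u v => [|N IH] u v /=; first by move=> -> ->; rewrite addr0.
by move=> Hu Hv; rewrite rmorphD scalerDr opprD addrACA; apply: IH.
Qed.

Lemma weight_vector_atZ l N c v : weight_vector_at l N v ->
  weight_vector_at l N (c *: v).
Proof.
elim: N v => [|N IH] v /=; first by move=> ->; rewrite scaler0.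
by move=> Hv; rewrite (linearZ_LR g) scalerA mulrC -scalerA -scalerBr; apply: IH.
Qed.

Lemma weight_vector_at_image l N v : weight_vector_at l N v ->
  weight_vector_at l N (g v).
Proof.
elim: N v => [|N IH] v /=; first by move=> ->; rewrite rmorph0.
by move=> /IH; rewrite rmorphB /= (linearZ_LR g).
Qed.

Lemma weight_vector_at_leq l N M v : (N <= M)%N -> weight_vector_at l N v ->
  weight_vector_at l M v.
Proof.
have step e w : weight_vector_at l e w -> weight_vector_at l e.+1 w.
  elim: e w => [|e IH] w; last exact: IH.
  by move=> -> /=; rewrite rmorph0 scaler0 subr0.
move=> /subnKC <- Hv; elim: (M - N)%N => [|e IH]; first by rewrite addn0.
by rewrite addnS; apply: step.
Qed.

Lemma weight_vector_at_sum l N M u v : weight_vector_at l N u ->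
  weight_vector_at l M v -> weight_vector l (u + v).
Proof.
move=> Hu Hv; exists (maxn N M); apply: weight_vector_atD.
  exact: weight_vector_at_leq (leq_maxl _ _) Hu.
exact: weight_vector_at_leq (leq_maxr _ _) Hv.
Qed.

Lemma weight_vectorD l u v : weight_vector l u -> weight_vector l v ->
  weight_vector l (u + v).
Proof. by move=> [N Hu] [M Hv]; apply: weight_vector_at_sum Hu Hv. Qed.

Lemma weight_vectorZ l c v : weight_vector l v -> weight_vector l (c *: v).
Proof. by move=> [N Hv]; exists N; apply: weight_vector_atZ. Qed.

Lemma weight_vectorB l u v : weight_vector l u -> weight_vector l v ->
  weight_vector l (u - v).
Proof.
move=> Hu Hv; rewrite -scaleN1r; apply: weight_vectorD => //.
by apply: weight_vectorZ.
Qed.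

Lemma weight_vector0 l : weight_vector l 0.
Proof. by exists 0%N. Qed.

Lemma weight_vector_sum l (I : eqType) (r : seq I) (P : pred I) (F : I -> A) :
  (forall i, i \in r -> P i -> weight_vector l (F i)) ->
  weight_vector l (\sum_(i <- r | P i) F i).
Proof.
move=> HF; rewrite big_seq_cond; elim/big_rec: _ => [|i x /andP[ir Pi]].
  exact: weight_vector0.
by apply: weight_vectorD; apply: HF.
Qed.

Lemma weight_vector_step l v : weight_vector l (g v - l *: v) -> weight_vector l v.
Proof. by move=> [N Hv]; exists N.+1. Qed.

Lemma weight_vector_diff l m v :
  weight_vector l v -> weight_vector l (g v - m *: v).
Proof.
move=> [N Hv]; apply: weight_vectorB.
  by exists N; apply: weight_vector_at_image.
by apply: weight_vectorZ; exists N.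
Qed.

Lemma weight_vector_cst c : weight_vector 1 (c *: 1).
Proof. by exists 1%N; rewrite /= (linearZ_LR g) rmorph1 scale1r subrr. Qed.

(** Induction on [N + M]: applying [g - l * m] to [u * v] gives two products, each with one of the
    two exponents lowered. *)
Lemma weight_vectorM l m u v : weight_vector l u -> weight_vector m v ->
  weight_vector (l * m) (u * v).
Proof.
move=> [N Hu] [M Hv]; have [e] := ubnP (N + M)%N.
elim: e N M u v Hu Hv => // e IH [|N] [|M] u v.
- by move=> /= ->; rewrite mul0r => _ _; apply: weight_vector0.
- by move=> /= ->; rewrite mul0r => _ _; apply: weight_vector0.
- by move=> _ /= ->; rewrite mulr0 => _; apply: weight_vector0.
move=> Hu Hv lt_e; apply: weight_vector_step.
have -> : g (u * v) - (l * m) *: (u * v) =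
    (g u - l *: u) * g v + (l *: u) * (g v - m *: v).
  rewrite rmorphM mulrBl mulrBr addrA subrK; congr (_ - _).
  by rewrite -scalerAl -scalerAr scalerA.
apply: weight_vectorD.
  apply: (IH N M.+1) => //.
  exact: weight_vector_at_image Hv.
apply: (IH N.+1 M) => //; last by rewrite addnS in lt_e.
exact: weight_vector_atZ Hu.
Qed.

Lemma weight_vector_commute (D : {linear A -> A}) l v :
  (forall f, g (D f) = D (g f)) -> weight_vector l v -> weight_vector l (D v).
Proof.
move=> gD [N Hv]; exists N; elim: N v Hv => [|N IH] v /=.
  by move=> ->; rewrite linear0.
by move=> /IH; rewrite linearB linearZ /= gD.
Qed.

Lemma weight_vector_eigen l m v : l != m -> g v = m *: v ->
  weight_vector l v -> v = 0.
Proof.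
move=> lm gv [N]; elim: N => [//|N IH] /=; rewrite gv -scalerBl => Hv.
have ml : m - l != 0 by rewrite subr_eq0 eq_sym.
apply: IH; have := weight_vector_atZ (m - l)^-1 Hv.
by rewrite scalerA mulVf // scale1r.
Qed.

(** Induction on the number of summands, then on the exponent of the first one, of weight [l].
    Applying [g - l] lowers that exponent and yields [g u = l *: u], which forces [u = 0] as [l]
    differs from [m]. *)
Lemma weight_disjoint m (L : seq (k * A)) u :
  (forall p, p \in L -> p.1 != m /\ weight_vector p.1 p.2) ->
  weight_vector m u -> u = \sum_(p <- L) p.2 -> u = 0.
Proof.
move: {2}(size L) (erefl (size L)) => e; elim: e => [|e IH] in L u *.
  by move=> /size0nil -> _ _; rewrite big_nil.
case: L => // [[l v] L] [sz_L] HL; have [/= lm [N Hv]] := HL _ (mem_head _ _).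
have {}HL p : p \in L -> p.1 != m /\ weight_vector p.1 p.2.
  by move=> pL; apply: HL; rewrite inE pL orbT.
elim: N v Hv L sz_L HL u => [|N IHN] v /= Hv L sz_L HL u Hu; rewrite big_cons /=.
  by rewrite Hv add0r; apply: IH.
move=> Du; apply: (@weight_vector_eigen m l) => //; first by rewrite eq_sym.
apply/eqP; rewrite -subr_eq0; apply/eqP.
apply: (IHN _ Hv [seq (p.1, g p.2 - l *: p.2) | p <- L]).
- by rewrite size_map.
- by move=> _ /mapP[p /HL[pm Hp] ->]; split=> //; apply: weight_vector_diff.
- exact: weight_vector_diff.
rewrite big_cons big_map /= sumrB -linear_sum -scaler_sumr addrACA -opprD.
by rewrite -scalerDr -linearD /= -Du.
Qed.

(** On vectors of weight [m], the operator [g - l] is the nonzero scalar [m - l] plus the locally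
    nilpotent [g - m]; the induction sums the geometric series of its inverse. *)
Lemma weight_vector_divide l m N w : m != l -> weight_vector_at m N w ->
  exists2 x, weight_vector_at m N x & g x - l *: x = w.
Proof.
move=> ml; have ml0 : m - l != 0 by rewrite subr_eq0.
elim: N w => [|N IH] w /= Hw.
  by exists 0; rewrite // rmorph0 scaler0 subr0.
have [y Hy Dy] := IH _ (weight_vector_atZ (- (m - l)^-1) Hw).
pose x := (m - l)^-1 *: w; exists (x + y).
  have -> : g (x + y) - m *: (x + y) =
      (m - l)^-1 *: (g w - m *: w) + (g y - m *: y).
    by rewrite /x rmorphD /= (linearZ_LR g) scalerDr opprD addrACA
      scalerBr !scalerA mulrC.
  apply: weight_vector_atD; first exact: weight_vector_atZ.
  by have := weight_vector_at_leq (leqnSn N) Hy.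
rewrite rmorphD /= scalerDr opprD addrACA Dy /x (linearZ_LR g) scaleNr scalerBr.
rewrite opprB addrC addrA subrK !scalerA -scalerBl [l * _]mulrC -mulrBr.
by rewrite mulVf // scale1r.
Qed.

Fixpoint annihilates (ls : seq k) (v : A) : Prop :=
  if ls is l :: ls' then annihilates ls' (g v - l *: v) else v = 0.

(** A decomposition of [g v - l *: v] is lifted through [g - l]: summands of weight other than [l]
    can be divided, and what remains of [v] is a single vector of weight [l]. *)
Lemma primary_decomposition ls v : annihilates ls v ->
  exists2 L : seq (k * A), v = \sum_(p <- L) p.2 &
    forall p, p \in L -> weight_vector p.1 p.2.
Proof.
elim: ls v => [|l ls IH] v /=; first by move=> ->; exists [::]; rewrite ?big_nil.
move=> /IH [L DL HL] {IH}.
suff [L' [HL' L'sum]] : exists L' : seq (k * A),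
    (forall p, p \in L' -> weight_vector p.1 p.2) /\
    weight_vector l (g (v - \sum_(p <- L') p.2) - l *: (v - \sum_(p <- L') p.2)).
  exists ((l, v - \sum_(p <- L') p.2) :: L').
    by rewrite big_cons /= subrK.
  by move=> p; rewrite inE => /predU1P[-> | /HL' //]; apply: weight_vector_step.
suff [L' [HL' L'sum]] : exists L' : seq (k * A),
    (forall p, p \in L' -> weight_vector p.1 p.2) /\
    weight_vector l (\sum_(p <- L) p.2 -
      (g (\sum_(p <- L') p.2) - l *: (\sum_(p <- L') p.2))).
  exists L'; split=> //; set S := \sum_(p <- L') p.2 in L'sum *.
  have -> : g (v - S) - l *: (v - S) = (g v - l *: v) - (g S - l *: S).
    rewrite rmorphB scalerBr !opprB addrACA [RHS]addrACA.
    by rewrite [- g S - _]addrC.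
  by rewrite DL.
elim: L HL {v DL} => [|[m w] L IH] HL.
  exists [::]; split=> //; rewrite !big_nil rmorph0 scaler0 !subr0.
  exact: weight_vector0.
have [|L' [HL' Hsum]] := IH; first by move=> p pL; apply: HL; rewrite inE pL orbT.
have /= Hw := HL _ (mem_head _ _); have [ml|ml] := eqVneq m l.
  exists L'; split=> //; rewrite big_cons -addrA; apply: weight_vectorD => //.
  by rewrite -ml.
have [N /(weight_vector_divide ml)[x Hx Dx]] := Hw.
exists ((m, x) :: L'); split=> [p|].
  by rewrite inE => /predU1P[->|/HL' //]; exists N.
rewrite !big_cons /= rmorphD /= scalerDr [- (l *: _ + _)]opprD (addrACA (g x)) Dx.
by rewrite opprD addrACA subrr add0r.
Qed.

Definition poly_act (q : {poly k}) (v : A) := \sum_(i < size q) q`_i *: iter i g v.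

Lemma poly_act_wide (q : {poly k}) e (v : A) : (size q <= e)%N ->
  poly_act q v = \sum_(i < e) q`_i *: iter i g v.
Proof.
move=> le_qe; rewrite /poly_act.
rewrite (big_ord_widen _ (fun i => q`_i *: iter i g v) le_qe).
rewrite big_mkcond; apply: eq_bigr => i _; case: ltnP => // le_qi.
by rewrite nth_default // scale0r.
Qed.

Lemma poly_act_factor l (q : {poly k}) (v : A) :
  poly_act (('X - l%:P) * q) v = poly_act q (g v - l *: v).
Proof.
rewrite (@poly_act_wide _ (size q).+1); last first.
  by rewrite (leq_trans (size_mul_leq _ _)) // size_XsubC.
have iter_diff i : iter i g (g v - l *: v) = iter i.+1 g v - l *: iter i g v.
  by elim: i => // i IH; rewrite iterS IH rmorphB /= (linearZ_LR g).
transitivity (\sum_(i < (size q).+1)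
    ((if i == 0%N :> nat then 0 else q`_i.-1) *: iter i g v -
     (l * q`_i) *: iter i g v)).
  by apply: eq_bigr => i _; rewrite mulrBl coefB coefXM coefCM scalerBl.
rewrite sumrB big_ord_recl /= scale0r add0r big_ord_recr /=.
rewrite [q`_(size q)]nth_default // mulr0 scale0r addr0 -sumrB.
apply: eq_bigr => i _; rewrite iter_diff scalerBr scalerA [q`_i * l]mulrC.
by [].
Qed.

Lemma poly_act_annihilates ls v :
  poly_act (\prod_(l <- ls) ('X - l%:P)) v = 0 -> annihilates ls v.
Proof.
elim: ls v => [|l ls IH] v /=.
  by rewrite big_nil /poly_act size_poly1 big_ord1 coef1 scale1r.
by rewrite big_cons poly_act_factor; apply: IH.
Qed.

End WeightSpaces.

Section LocallyFinite.
Context (k : closedFieldType) (n : nat).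
Notation A := {mpoly k[n]}.
Context (g : {lrmorphism A -> A}).

(** The iterates of [v] lie in a space of finite dimension [N], so the first [N.+1] of them satisfy
    a linear relation; it is a polynomial in [g] that kills [v] and splits over [k]. *)
Lemma locally_finite_decomposition (v : A) d :
  (forall i, (msize (iter i g v) <= d)%N) ->
  exists2 L : seq (k * A), v = \sum_(p <- L) p.2 &
    forall p, p \in L -> weight_vector g p.1 p.2.
Proof.
move=> v_d; set N := #|{: 'X_{1..n < d}}|.
pose M : 'M[k]_(N.+1, N) := \matrix_(i, j) (iter i g v)@_(val (enum_val j)).
have [u u_n0 uM] : exists2 u : 'rV[k]_N.+1, u != 0 & u *m M = 0.
  have : kermx M != 0.
    rewrite -mxrank_eq0 mxrank_ker subn_eq0 -ltnNge.
    by rewrite ltnS rank_leq_col.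
  by case/rowV0Pn => u /sub_kermxP uM u_n0; exists u.
pose q : {poly k} := \poly_(i < N.+1) u 0 (inord i).
have q_n0 : q != 0.
  apply: contraNneq u_n0 => q0; apply/eqP/rowP => i; rewrite mxE.
  have := congr1 (fun f : {poly k} => f`_i) q0.
  by rewrite coef_poly ltn_ord inord_val coef0.
have q_act : poly_act g q v = 0.
  rewrite (@poly_act_wide _ _ _ _ N.+1) ?size_poly //; apply/mpolyP => m.
  rewrite mcoeff0 raddf_sum /=; have [lt_md|le_dm] := ltnP (mdeg m) d.
    have := congr1 (fun w : 'rV_N => w 0 (enum_rank (BMultinom lt_md))) uM.
    rewrite !mxE => E; rewrite -[RHS]E; apply: eq_bigr => i _.
    by rewrite mcoeffZ coef_poly ltn_ord inord_val !mxE enum_rankK.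
  rewrite big1 // => i _; rewrite mcoeffZ [X in _ * X]memN_msupp_eq0 ?mulr0 //.
  by apply: msize_mdeg_ge; apply: leq_trans (v_d i) le_dm.
have [ls Dq] := closed_field_poly_normal q.
apply: (@primary_decomposition _ _ _ ls); apply: poly_act_annihilates.
have lc_n0 : lead_coef q != 0 by rewrite lead_coef_eq0.
move: q_act; rewrite Dq {1}/poly_act size_scale //.
move=> /(congr1 (fun w => (lead_coef q)^-1 *: w)).
rewrite scaler0 scaler_sumr => E; rewrite -[RHS]E; apply: eq_bigr => i _.
by rewrite coefZ !scalerA mulrA mulVf // mul1r.
Qed.

End LocallyFinite.

(** * The [D]-stable ideal attached to a submonoid of scalars *)

Section WeightIdeal.
Context (k : fieldType) (n : nat).
Notation A := {mpoly k[n]}.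
Context (D : {linear A -> A}) (D_der : leibniz D) (D_simple : simple D).
Context (g : {lrmorphism A -> A}) (gD : forall f, g (D f) = D (g f)).
Context (r : nat) (lam : 'I_r -> k) (v : 'I_r -> A).
Hypothesis v_weight : forall j, weight_vector g (lam j) (v j).
Hypothesis v_gen : forall i, exists js : seq 'I_r, 'X_i = \sum_(j <- js) v j.

Section Submonoid.
Context (Gam : k -> Prop) (Gam1 : Gam 1).
Hypothesis GamM : forall l m, Gam l -> Gam m -> Gam (l * m).

Definition weight_ideal : set A := [set f | exists a : 'I_r -> A,
  f = \sum_(j | `[< ~ Gam (lam j) >]) a j * v j].

Lemma weight_ideal_ideal : ideal weight_ideal.
Proof.
split=> [|f f' [a ->] [b ->]|f f' [a ->]].
- by exists (fun=> 0); rewrite big1 // => j _; rewrite mul0r.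
- exists (fun j => a j + b j); rewrite -big_split; apply: eq_bigr => j _.
  by rewrite mulrDl.
exists (fun j => f * a j); rewrite mulr_sumr.
by apply: eq_bigr => j _; rewrite mulrA.
Qed.

Lemma weight_ideal_sum (I : eqType) (s : seq I) (P : pred I) (F : I -> A) :
  (forall i, i \in s -> P i -> weight_ideal (F i)) ->
  weight_ideal (\sum_(i <- s | P i) F i).
Proof.
have [J0 JD _] := weight_ideal_ideal.
move=> HF; rewrite big_seq_cond; elim/big_rec: _ => // i x /andP[si Pi] Hx.
by apply: (JD) => //; apply: HF.
Qed.

Lemma weight_ideal_gen j : ~ Gam (lam j) -> weight_ideal (v j).
Proof.
move=> Gj; exists (fun i => (i == j)%:R); rewrite (bigD1 j) /=; last exact/asboolP.
by rewrite eqxx mul1r big1 ?addr0 // => i /andP[_ /negPf ->]; rewrite mul0r.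
Qed.

(** If a product of two weights is outside the submonoid [Gam], so is one of the factors; hence
    membership in the ideal passes to products of components. *)
Lemma weight_decomposition f : exists2 M : seq (k * A), f = \sum_(p <- M) p.2 &
  forall p, p \in M -> weight_vector g p.1 p.2 /\ (~ Gam p.1 -> weight_ideal p.2).
Proof.
have [J0 JD JM] := weight_ideal_ideal.
elim/mpoly_ring_ind: f => [c|i|p q [M DM HM] [N DN HN]|p q [M DM HM] [N DN HN]].
- exists [:: (1, c%:MP)]; rewrite ?big_seq1 // => p; rewrite inE => /eqP -> /=.
  by rewrite -alg_mpolyC; split=> //; apply: weight_vector_cst.
- have [js ->] := v_gen i; exists [seq (lam j, v j) | j <- js].
    by rewrite big_map.
  by move=> _ /mapP[j _ ->] /=; split=> //; apply: weight_ideal_gen.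
- exists (M ++ N); first by rewrite big_cat DM DN.
  by move=> u; rewrite mem_cat => /orP[/HM|/HN].
exists [seq (x.1 * y.1, x.2 * y.2) | x <- M, y <- N].
  rewrite big_allpairs_dep DM DN mulr_suml.
  by apply: eq_bigr => x _; rewrite mulr_sumr.
move=> _ /allpairsP[[x y] /= [/HM[Hx Jx] /HN[Hy Jy] ->]] /=; split.
  exact: weight_vectorM.
move=> Gxy; have [Gx|/Jx Jx'] := pselect (Gam x.1); last first.
  by rewrite mulrC; apply: JM.
by apply: JM; apply: Jy => Gy; apply: Gxy; apply: GamM.
Qed.

(** [D] commutes with [g] and so preserves weights. By independence of weight spaces, only the
    components of weight [lam j] contribute to [D (v j)], and these lie in the ideal. *)
Lemma weight_ideal_derivation f : weight_ideal f -> weight_ideal (D f).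
Proof.
have [J0 JD JM] := weight_ideal_ideal.
move=> [a ->]; rewrite linear_sum; apply: weight_ideal_sum => j _ /asboolP Gj.
rewrite D_der; apply: (JD); first by apply: JM; apply: weight_ideal_gen.
apply: JM; have [M DM HM] := weight_decomposition (D (v j)).
have Dv_weight := weight_vector_commute gD (v_weight j).
suff -> : D (v j) = \sum_(p <- M | p.1 == lam j) p.2.
  by apply: weight_ideal_sum => p /HM[_ Jp] /eqP pj; apply: Jp; rewrite pj.
apply/eqP; rewrite -subr_eq0; apply/eqP.
apply: (@weight_disjoint _ _ g (lam j) [seq p <- M | p.1 != lam j]).
- by move=> p; rewrite mem_filter => /andP[pj /HM[]].
- apply: weight_vectorB => //; apply: weight_vector_sum => p /HM[Hp _] /eqP <- //.
by rewrite big_filter {1}DM (bigID (fun p => p.1 == lam j)) /= addrAC subrr add0r.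
Qed.

Lemma weight_certificate j0 : ~ Gam (lam j0) -> v j0 != 0 -> weight_ideal 1.
Proof.
move=> Gj vj.
case: (D_simple weight_ideal_ideal weight_ideal_derivation) => [J0|->//].
by have := weight_ideal_gen Gj; rewrite J0 => /eqP; rewrite (negPf vj).
Qed.

End Submonoid.

(* The ideal of a submonoid only depends on the finite set of indices outside it,
   hence finitely many certificates serve all submonoids. *)
Lemma uniform_certificates : exists a : {set 'I_r} -> 'I_r -> A,
  forall Gam : k -> Prop, Gam 1 -> (forall l m, Gam l -> Gam m -> Gam (l * m)) ->
  (exists2 j0, ~ Gam (lam j0) & v j0 != 0) ->
  let S := [set j | `[< ~ Gam (lam j) >]]%SET in 1 = \sum_(j in S) a S j * v j.
Proof.
have /choice [a Ha] (S : {set 'I_r}) : exists a : 'I_r -> A,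
    (exists b : 'I_r -> A, 1 = \sum_(j in S) b j * v j) ->
    1 = \sum_(j in S) a j * v j.
  have [[b Hb]|N] := pselect (exists b : 'I_r -> A, 1 = \sum_(j in S) b j * v j).
    by exists b.
  by exists (fun=> 0) => /N.
exists a => Gam Gam1 GamM [j0 Gj vj] S; apply: Ha.
have [b ->] := weight_certificate Gam1 GamM Gj vj.
by exists b; apply: eq_bigl => j; rewrite inE.
Qed.

End WeightIdeal.

(** * Weight vectors under change of coefficients and at periodic points *)

Section Substitution.
Context (n : nat).

Lemma map_mpoly_substitution (R S : comNzRingType) (f : {rmorphism R -> S})
    (G : 'I_n -> {mpoly R[n]}) (p : {mpoly R[n]}) :
  map_mpoly f (p \mPo [tuple G i | i < n]) =
  map_mpoly f p \mPo [tuple map_mpoly f (G i) | i < n].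
Proof.
elim/mpoly_ring_ind: p => [c|i|p q IHp IHq|p q IHp IHq].
- by rewrite comp_mpolyC !map_mpolyC comp_mpolyC.
- by rewrite map_mpolyX !comp_mpolyXU -!tnth_nth !tnth_mktuple.
- by rewrite !raddfD /= IHp IHq ?raddfD.
by rewrite !rmorphM /= IHp IHq ?rmorphM.
Qed.

(** This is [g - l] expressed through the images [G] of the variables: it makes sense over any
    commutative ring and is compatible with maps of coefficients. *)
Definition weight_op (R : comNzRingType) (G : 'I_n -> {mpoly R[n]}) (l : R)
    (p : {mpoly R[n]}) := p \mPo [tuple G i | i < n] - l *: p.

Lemma map_iter_weight_op (R S : comNzRingType) (f : {rmorphism R -> S}) G l N p :
  map_mpoly f (iter N (weight_op G l) p) =
  iter N (weight_op (fun i => map_mpoly f (G i)) (f l)) (map_mpoly f p).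
Proof.
elim: N => // N IH; rewrite !iterS -IH /weight_op rmorphB /=.
by rewrite map_mpoly_substitution map_mpolyZ.
Qed.

Lemma weight_vector_at_op (k : fieldType)
    (g : {lrmorphism {mpoly k[n]} -> {mpoly k[n]}}) l N p :
  weight_vector_at g l N p -> iter N (weight_op (fun i => g 'X_i) l) p = 0.
Proof.
elim: N p => // N IH p Hp; rewrite iterSr.
have -> : weight_op (fun i => g 'X_i) l p = g p - l *: p.
  by rewrite /weight_op -(lrmorphism_comp_mpoly g).
exact: IH.
Qed.

Section Points.
Context (F : fieldType) (G : 'I_n -> {mpoly F[n]}).
Notation point := {ffun 'I_n -> F}.

Definition point_map (x : point) : point := [ffun i => (G i).@[x]].

Lemma meval_substitution p (x : point) :
  (p \mPo [tuple G i | i < n]).@[x] = p.@[point_map x].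
Proof.
rewrite comp_mpoly_meval; apply: meval_eq => i.
by rewrite tnth_mktuple ffunE.
Qed.

(** By induction [(g - l) p] vanishes along the orbit of [x], so [p] is multiplied by [l] at each
    step; returning to [x] after [r] steps gives [p(x) = l ^+ r * p(x)]. *)
Lemma periodic_weight_vanish r l N p (x : point) : iter N (weight_op G l) p = 0 ->
  iter r point_map x = x -> l ^+ r != 1 -> p.@[x] = 0.
Proof.
move=> + + lr; elim: N p x => [|N IH] p x; first by move=> /= ->; rewrite meval0.
rewrite iterSr => Hp xr.
have iter_r i : iter r point_map (iter i point_map x) = iter i point_map x.
  by rewrite -iterD addnC iterD xr.
have step i : p.@[iter i point_map x] = l ^+ i * p.@[x].
  elim: i => [|i IHi]; first by rewrite mul1r.
  have := IH _ _ Hp (iter_r i); rewrite mevalB mevalZ meval_substitution -iterS.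
  by move/eqP; rewrite subr_eq0 IHi mulrA -exprS => /eqP.
have := step r; rewrite xr => /eqP; rewrite -subr_eq0 -{1}[p.@[x]]mul1r -mulrBl.
by rewrite mulf_eq0 subr_eq0 eq_sym (negPf lr) => /eqP.
Qed.

End Points.
End Substitution.

Lemma lift_mpoly (n : nat) (R S : comNzRingType) (ev : {rmorphism R -> S})
    (p : {mpoly S[n]}) :
  (forall m, m \in msupp p -> exists t, ev t = p@_m) ->
  exists q, map_mpoly ev q = p.
Proof.
move=> Hp; have /choice [c Hc] (m : 'X_{1..n}) : exists t, ev t = p@_m.
  have [/Hp //|/memN_msupp_eq0 ->] := boolP (m \in msupp p).
  by exists 0; rewrite rmorph0.
exists (\sum_(m <- msupp p) c m *: 'X_[m]).
rewrite [in RHS](mpolyE p) raddf_sum; apply: eq_bigr => m _.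
by rewrite /= map_mpolyZ map_mpolyX Hc.
Qed.

Lemma finField_expf_card (F : finFieldType) (x : F) : x != 0 -> x ^+ #|F|.-1 = 1.
Proof.
move=> x0; apply: (mulfI x0); rewrite mulr1 -exprS prednK ?expf_card //.
exact: ltnW (finNzRing_gt1 F).
Qed.

(* For r the prime-to-p part of the order of s, the powers of s^r form a p-group,
   which has a fixed point. *)
Lemma perm_fixed_power (X : finType) (s : {perm X}) (p : nat) :
  prime p -> ~~ (p %| #|X|)%N -> exists (r : nat) (x : X),
    ~~ (p %| r)%N /\ iter r s x = x.
Proof.
move=> p_pr pX; pose r := (#[s]%g`_p^')%N.
exists r; have pgr : (p.-group <[s ^+ r]>)%g.
  rewrite /pgroup -orderE orderXdiv ?dvdn_part //.
  by rewrite -{1}(partnC p (fingroup.order_gt0 s)) mulnK ?part_pnat // part_gt0.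
have acts : [acts <[s ^+ r]>, on [set: X]%SET | 'P]%g.
  by apply/actsP => a _ x; rewrite !inE.
have := pgroup_fix_mod pgr acts; rewrite cardsT finset.setTI => fix_mod.
have /card_gt0P [x] : (0 < #|('Fix_('P)(<[s ^+ r]>))%g|)%N.
  rewrite lt0n; apply: contraNneq pX => fix0.
  by rewrite /dvdn fix_mod fix0 mod0n.
move=> /afixP/(_ _ (cycle_id _)) /= sx; exists x; split.
  by rewrite -prime_coprime // (pnat_coprime (pnat_id p_pr)) // part_pnat.
by rewrite -permX.
Qed.

(** * Triviality of the weights by reduction to a finite field *)

Section WeightsTrivial.
Context (k : fieldType) (char0 : [pchar k] =i pred0) (n : nat).
Notation A := {mpoly k[n]}.
Context (D : {linear A -> A}) (D_der : leibniz D) (D_simple : simple D).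
Context (g : autA k n) (gD : autD (affine_emb k n) D g).
Context (r : nat) (lam : 'I_r -> k) (v : 'I_r -> A).
Hypothesis v_weight : forall j, weight_vector g (lam j) (v j).
Hypothesis v_gen : forall i, exists js : seq 'I_r, 'X_i = \sum_(j <- js) v j.
Hypothesis v_neq0 : forall j, v j != 0.

Lemma weight_neq0 j : lam j != 0.
Proof.
apply/eqP => lj0; have [N] := v_weight j; rewrite lj0.
elim: N (v j) (v_neq0 j) => [|N IH] w w0 /=; first by move/eqP; rewrite (negPf w0).
rewrite scale0r subr0; apply: IH; apply: contraNneq w0 => gw0.
by rewrite -(aut_funK g w) gw0 rmorph0.
Qed.

(* A prime p dividing the order of a weight lam j0 <> 1 reduced to a finite field F
   forces every power prime to p of the reduction of g to act on F^n without fixed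
   point, although #|F|^n is prime to p. *)
Lemma weights_trivial j0 : lam j0 = 1.
Proof.
apply: contrapT => /eqP lam_n1.
have [a cert] := uniform_certificates D_der D_simple gD v_weight v_gen.
have /choice [N HN] j : exists N, weight_vector_at g (lam j) N (v j) := v_weight j.
pose coefs (p : A) := [seq p@_m | m <- msupp p].
(* The coefficients of the inverse of [g] keep its reduction bijective on points; the inverses of
   scalars keep the reduced weights nonzero and that of [lam j0] different from 1. *)
pose cs := flatten [seq coefs (g 'X_i) | i <- enum 'I_n] ++
  flatten [seq coefs (g^-1%g 'X_i) | i <- enum 'I_n] ++
  flatten [seq coefs (v i) | i <- enum 'I_r] ++
  flatten [seq flatten [seq coefs (a Z i) | i <- enum 'I_r]
          | Z <- enum {set 'I_r}] ++
  [seq lam i | i <- enum 'I_r] ++ [seq (lam i)^-1 | i <- enum 'I_r] ++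
  [:: (lam j0 - 1)^-1].
have [T [F [ev [th [ker_th cs_ev]]]]] := finite_field_specialization char0 cs.
have transfer x y : ev x = ev y -> th x = th y.
  move=> xy; apply/eqP; rewrite -subr_eq0 -rmorphB; apply/eqP/ker_th.
  by rewrite rmorphB xy subrr.
have transferP (p q : {mpoly T[n]}) :
    map_mpoly ev p = map_mpoly ev q -> map_mpoly th p = map_mpoly th q.
  move=> pq; apply/mpolyP => m; rewrite !mcoeff_map_mpoly; apply: transfer.
  by rewrite -!mcoeff_map_mpoly pq.
have lift (p : A) : {subset coefs p <= cs} -> exists q, map_mpoly ev q = p.
  move=> p_cs; apply: lift_mpoly => m mp; apply: cs_ev; apply: p_cs.
  exact: map_f.
have flatten_sub (I : finType) (B : I -> seq k) i :
    {subset B i <= flatten [seq B x | x <- enum I]}.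
  by move=> c ci; apply/flattenP; exists (B i) => //; apply/map_f; rewrite mem_enum.
have /choice [G HG] i : exists q, map_mpoly ev q = g 'X_i.
  apply: lift => c ci.
  by rewrite !mem_cat (flatten_sub _ (fun i => coefs (g 'X_i)) i).
have /choice [G' HG'] i : exists q, map_mpoly ev q = g^-1%g 'X_i.
  apply: lift => c ci.
  by rewrite !mem_cat (flatten_sub _ (fun i => coefs (g^-1%g 'X_i)) i) ?orbT.
have /choice [w Hw] i : exists q, map_mpoly ev q = v i.
  apply: lift => c ci.
  by rewrite !mem_cat (flatten_sub _ (fun i => coefs (v i)) i) ?orbT.
have /choice [b Hb] (Si : {set 'I_r} * 'I_r) :
    exists q, map_mpoly ev q = a Si.1 Si.2.
  apply: lift => c ci; rewrite !mem_cat.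
  pose cert_coefs Z := flatten [seq coefs (a Z i) | i <- enum 'I_r].
  rewrite (flatten_sub _ cert_coefs Si.1) ?orbT //.
  exact: (flatten_sub _ (fun i => coefs (a Si.1 i)) Si.2).
have /choice [mu Hmu] i : exists t, ev t = lam i.
  by apply: cs_ev; rewrite !mem_cat (map_f lam) ?orbT // mem_enum.
have /choice [mu' Hmu'] i : exists t, ev t = (lam i)^-1.
  by apply: cs_ev; rewrite !mem_cat (map_f (fun i => (lam i)^-1)) ?orbT // mem_enum.
have [z Hz] : exists t, ev t = (lam j0 - 1)^-1.
  by apply: cs_ev; rewrite !mem_cat mem_head !orbT.
have mu_n0 i : th (mu i) != 0.
  have : th (mu i * mu' i) = th 1.
    by apply: transfer; rewrite rmorphM Hmu Hmu' rmorph1 divff // weight_neq0.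
  rewrite rmorphM rmorph1 => E; apply: contra_eq_neq E => ->.
  by rewrite mul0r eq_sym oner_neq0.
have mu_n1 : th (mu j0) != 1.
  have : th ((mu j0 - 1) * z) = th 1.
    apply: transfer; rewrite rmorphM rmorphB Hmu Hz !rmorph1 divff //.
    by rewrite subr_eq0.
  rewrite rmorphM rmorphB !rmorph1 => E; apply: contra_eq_neq E => ->.
  by rewrite subrr mul0r eq_sym oner_neq0.
have F_gt1 := finNzRing_gt1 F.
have F1_gt0 : (0 < #|F|.-1)%N by rewrite -ltnS prednK // ltnW.
have mu_order i : {o | (o.-primitive_root (th (mu i))) & (o %| #|F|.-1)%N}.
  exact: prim_order_exists F1_gt0 (finField_expf_card (mu_n0 i)).
have [o o_prim o_dvd] := mu_order j0.
have o_gt1 : (1 < o)%N.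
  case: o o_prim {o_dvd} => [|[|o]] // o_prim.
  by have := prim_expr_order o_prim; rewrite expr1 => /eqP; rewrite (negPf mu_n1).
pose p := pdiv o; have p_pr : prime p := pdiv_prime o_gt1.
(* Orders of elements of the multiplicative group of [F] divide [#|F|.-1], so an order is prime to
   [p] exactly when it divides [M]. *)
pose M := (#|F|.-1`_p^')%N.
have pM : ~~ (p %| M)%N.
  by rewrite -prime_coprime // (pnat_coprime (pnat_id p_pr)) // part_pnat.
pose Gam (l : k) := exists2 t, ev t = l & th t ^+ M = 1.
have Gam1 : Gam 1 by exists 1; rewrite rmorph1 // expr1n.
have GamM l m : Gam l -> Gam m -> Gam (l * m).
  move=> [t <- tM] [u <- uM]; exists (t * u); rewrite rmorphM //.
  by rewrite exprMn tM uM mulr1.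
have GamE i : Gam (lam i) <-> th (mu i) ^+ M = 1.
  split=> [[t tE tM]|muM]; last by exists (mu i).
  by rewrite -(transfer t) // tE Hmu.
have Gj0 : ~ Gam (lam j0).
  move/GamE/eqP; rewrite -(prim_order_dvd o_prim) => oM; case/negP: pM.
  exact: dvdn_trans (pdiv_dvd o) oM.
have {}cert := cert Gam Gam1 GamM (ex_intro2 _ _ j0 Gj0 (v_neq0 j0)).
set S := finset _ in cert.
have {}cert : 1 = \sum_(i in S) map_mpoly th (b (S, i)) * map_mpoly th (w i).
  have : map_mpoly th 1 = map_mpoly th (\sum_(i in S) b (S, i) * w i).
    apply: transferP; rewrite rmorph1 cert rmorph_sum; apply: eq_bigr => i _.
    by rewrite rmorphM /= Hb Hw.
  rewrite rmorph1 rmorph_sum => ->; apply: eq_bigr => i _; exact: rmorphM.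
pose Gb i := map_mpoly th (G i); pose Gb' i := map_mpoly th (G' i).
have GbK i : Gb' i \mPo [tuple Gb l | l < n] = 'X_i.
  rewrite -map_mpoly_substitution -(map_mpolyX th); apply: transferP.
  rewrite map_mpoly_substitution map_mpolyX HG' (eq_mktuple _ HG).
  by rewrite -(lrmorphism_comp_mpoly g) aut_invK.
have pm_inj : injective (point_map Gb).
  apply: (can_inj (g := point_map Gb')) => x; apply/ffunP => i.
  by rewrite ffunE -(meval_substitution Gb) GbK mevalXU.
have pX : ~~ (p %| #|{: {ffun 'I_n -> F}}|)%N.
  rewrite card_ffun card_ord -prime_coprime // coprimeXr // prime_coprime //.
  rewrite -(prednK (ltnW F_gt1)) -addn1 dvdn_addr; last first.
    exact: dvdn_trans (pdiv_dvd o) o_dvd.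
  by rewrite dvdn1 neq_ltn prime_gt1 ?orbT.
have [e [x [pe sx]]] := perm_fixed_power (perm pm_inj) p_pr pX.
have [i iS wi] : exists2 i, i \in S & (map_mpoly th (w i)).@[x] != 0.
  apply: contrapT => nz; have := congr1 (meval x) cert.
  rewrite meval1 raddf_sum big1 => [/eqP|i iS /=]; first by rewrite oner_eq0.
  rewrite mevalM; case: (eqVneq (map_mpoly th (w i)).@[x] 0) => [->|wi].
    by rewrite mulr0.
  by case: nz; exists i.
(* A weight vector that is nonzero at the periodic point [x] has a weight of order dividing [e],
   thus prime to [p]; this contradicts [i \in S]. *)
have mu_e : th (mu i) ^+ e = 1.
  apply: contrapT => /eqP mu_e; case/eqP: wi.
  apply: (@periodic_weight_vanish _ _ Gb e (th (mu i)) (N i) _ x) => //; last first.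
    by rewrite -{2}sx; apply: eq_iter => y; rewrite permE.
  rewrite /Gb -map_iter_weight_op -(rmorph0 (map_mpoly th)); apply: transferP.
  rewrite map_iter_weight_op rmorph0 Hmu Hw (funext HG).
  exact: weight_vector_at_op (HN i).
have [oi oi_prim oi_dvd] := mu_order i.
move: iS; rewrite inE => /asboolP; apply; apply/GamE.
apply/eqP; rewrite -(prim_order_dvd oi_prim).
have oi_e : (oi %| e)%N by rewrite (prim_order_dvd oi_prim) mu_e.
have : coprime oi (#|F|.-1`_p)%N.
  apply: coprime_dvdl oi_e _; rewrite p_part coprimeXr // coprime_sym.
  by rewrite prime_coprime.
by move/Gauss_dvdr => <-; rewrite partnC.
Qed.

End WeightsTrivial.

(** * Unipotence of the elements of [Aut(D)] and conclusion *)

Section Conclusion.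
Context (k : closedFieldType) (char0 : [pchar k] =i pred0) (n : nat).
Notation A := {mpoly k[n]}.
Context (D : {linear A -> A}) (D_der : leibniz D) (D_simple : simple D).
Notation G := (autD (affine_emb k n) D).

Lemma aut_expE (g : autA k n) m f : (g ^+ m)%g f = iter m g f.
Proof. by elim: m => // m IH; rewrite expgS iterS -IH. Qed.

Lemma autD_exp (g : autA k n) m : G g -> G (g ^+ m)%g.
Proof.
move=> gD f; rewrite !aut_expE.
by elim: m => // m IH; rewrite !iterS IH gD.
Qed.

Lemma sum_subset_indexed (V : nmodType) (L s : seq (k * V)) :
  {subset s <= L} -> exists js : seq 'I_(size L),
    \sum_(p <- s) p.2 = \sum_(j <- js) (nth (0, 0) L j).2.
Proof.
elim: s => [|p s IH] sL; first by exists [::]; rewrite !big_nil.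
have [|js Es] := IH; first by move=> q qs; apply: sL; rewrite inE qs orbT.
have pL : p \in L by apply: sL; apply: mem_head.
have lt_pL : (index p L < size L)%N by rewrite index_mem.
by exists (Ordinal lt_pL :: js); rewrite !big_cons Es /= nth_index.
Qed.

(** The nonzero weight components of the variables generate [A], so [weights_trivial] applies to all
    of them. *)
Lemma bounded_powers_unipotent (g : autA k n) p : G g ->
  (forall m, aut_piece p (g ^+ m)%g) -> forall i, weight_vector g 1 'X_i.
Proof.
move=> gD g_p.
have /choice [Ls HLs] i : exists L : seq (k * A), 'X_i = \sum_(q <- L) q.2 /\
    forall q, q \in L -> weight_vector g q.1 q.2.
  have [|L DL HL] := @locally_finite_decomposition _ _ g 'X_i p.+1; last first.
    by exists L.
  by move=> m; rewrite -aut_expE; apply: (aut_piece_affineE p (g ^+ m)%g).1.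
(* Zero components are discarded, as the zero vector has every weight. *)
pose nz i := [seq q <- Ls i | q.2 != 0].
pose L := flatten [seq nz i | i <- enum 'I_n].
have nzE i : 'X_i = \sum_(q <- nz i) q.2.
  rewrite (HLs i).1 big_filter [LHS](bigID (fun q => q.2 != 0)) /=.
  rewrite [X in _ + X]big1 ?addr0 // => q; rewrite negbK => /eqP ->.
  by [].
have L_weight q : q \in L -> weight_vector g q.1 q.2 /\ q.2 != 0.
  move/flattenP=> [_ /mapP[i _ ->]]; rewrite mem_filter => /andP[q0 qL].
  by split=> //; apply: (HLs i).2.
have L_gen i : exists js : seq 'I_(size L),
    'X_i = \sum_(j <- js) (nth (0, 0) L j).2.
  have [q qi|js E] := @sum_subset_indexed _ L (nz i).
    by apply/flattenP; exists (nz i) => //; apply: map_f; rewrite mem_enum.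
  by exists js; rewrite nzE.
have w1 (j : 'I_(size L)) : weight_vector g (nth (0, 0) L j).1 (nth (0, 0) L j).2.
  by apply: (L_weight _ _).1; apply: mem_nth.
have w0 (j : 'I_(size L)) : (nth (0, 0) L j).2 != 0.
  by apply: (L_weight _ _).2; apply: mem_nth.
move=> i; have [js ->] := L_gen i; apply: weight_vector_sum => j _ _.
by have := w1 j; rewrite (weights_trivial char0 D_der D_simple gD w1 L_gen w0 j).
Qed.

Lemma autD_connected p : G `<=` aut_piece p -> G = identity_component G.
Proof.
move=> G_p; apply/seteqP; split=> [g gD|]; last exact: connected_component_sub.
have g_p m : aut_piece p (g ^+ m)%g by apply: G_p; apply: autD_exp.
have /choice [P HP] i : exists P : {poly A}, forall m, iter m g 'X_i = P.[m%:R].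
  have [N HN] := bounded_powers_unipotent gD g_p i.
  apply: (@iter_polynomial _ char0 A g 'X_i N).
  elim: N 'X_i HN => // N IH f; rewrite iterSr /= scale1r; exact: IH.
apply: (@connected_component_max _ _ (range (fun m => (g ^+ m)%g))).
- by exists 0%N.
- by move=> _ [m _ <-]; apply: autD_exp.
- apply: (connected_powers char0 (P := P) (p := p)) => // m i.
  by rewrite aut_expE HP.
by exists 1%N; rewrite ?expg1.
Qed.

End Conclusion.

Theorem theorem5p4 (k : closedFieldType) (char0 : [pchar k] =i pred0)
  (n : nat) (D : {linear {mpoly k[n]} -> {mpoly k[n]}})
  (D_der : leibniz D) (D_simple : simple D)
  (s : nat) (s_ge1 : (1 <= s)%N)
  (H : set (autA k n))
  (H_normal : normal_subgroup (autD (affine_emb k n) D) H)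
  (H_nontrivial : H <> [set 1%g])
  (h : 'rV[k]_s -> autA k n) (h_iso : isomorphic_Ga H h)
  (h_regular : regular_action h)
  (B : comAlgType k) (B_reduced : reduced B)
  (m : nat) (emb : {lrmorphism {mpoly k[m]} -> B})
  (emb_closed : closed_embedding emb)
  (Psi : {rmorphism {mpoly k[n]} -> {mpoly B[s]}})
  (Psi_triv : equivariant_trivialization h Psi)
  (Dbar : B -> B) (Dbar_restr : is_restriction Psi D Dbar) :
  algebraic (autD emb Dbar) ->
  algebraic (autD (affine_emb k n) D) /\
  autD (affine_emb k n) D = identity_component (autD (affine_emb k n) D).
Proof.
move=> [_ [p Dbar_p]].
have bounded := orbit_bounded_trivialization char0 D_der D_simple H_normal h_iso
  emb_closed Psi_triv Dbar_restr Dbar_p.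
have /choice [d Hd] i := bounded 'X_i.
(* [d i] bounds [msize], which is the degree plus one, so the maximum is an ample bound on the
   degrees. *)
have G_piece : autD (affine_emb k n) D `<=` aut_piece (\max_i d i).
  move=> phi phiD; apply/aut_piece_affineE => i.
  by rewrite (leq_trans (Hd i _ phiD)) // leqW // leq_bigmax.
split; last exact: autD_connected G_piece.
by split; [exact: autD_closed | exists (\max_i d i)%N].
Qed.
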